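(* Let $S$ take values in a sample space $\mathcal{S}$ with distribution $F$ having density $f$ with respect to a reference measure $\mu$, and let $\omega\sim G$, independent of $S$, where $G$ has density $g$ with respect to Lebesgue measure on $\mathbb{R}^p$. Let $\lambda>0$ and let $\ell(\beta;s)$ be convex in $\beta\in\mathbb{R}^p$ and continuously twice differentiable in $\beta$, with gradient $\gamma(s,\beta)=\partial_\beta\ell(\beta;s)$. Let $\hat\beta=\hat\beta(S,\omega)$ be the (assumed unique) minimizer of $\ell(\beta;S)+\lambda\|\beta\|_1-\omega^T\beta$ and let $\hat z=\lambda^{-1}(\omega-\gamma(S,\hat\beta))$, so that $\hat z\in\partial\|\hat\beta\|_1$ and $\omega=\gamma(S,\hat\beta)+\lambda\hat z$. Fix $E\subseteq\{1,\dots,p\}$ and let $$\mathcal{B}=\{(\beta,z):\ \beta_{-E}=0,\ \mathrm{sign}(\beta_E)=z_E,\ \|z_{-E}\|_\infty<1\}.$$ Define the reconstruction map $\psi(s,\beta,z)=(s,\gamma(s,\beta)+\lambda z)$. Then, conditionally on the event $\{(\hat\beta,\hat z)\in\mathcal{B}\}$ (assumed to have positive probability), the law of $(S,\hat\beta,\hat z)$ is that of $(S,\hat\beta,\hat z)$ subject to $(\hat\beta,\hat z)\in\mathcal{B}$ and $(S,\gamma(S,\hat\beta)+\lambda\hat z)\sim F\times G$; concretely, parametrizing $(\beta,z)\in\mathcal{B}$ by $(\beta_E,z_{-E})$ (with $\beta=(\beta_E,0)$ and $z=(\mathrm{sign}(\beta_E),z_{-E})$), the random vector $(S,\hat\beta_E,\hat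 z_{-E})$ has density with respect to $\mu(ds)\otimes\mathrm{Leb}$ proportional to $$f(s)\cdot g\big(\gamma(s,\beta)+\lambda z\big)\cdot J\psi(s,\beta,z)\cdot 1_{\mathcal{B}}(\beta,z),$$ where $J\psi(s,\beta,z)$ is the determinant of the derivative of $\psi(s,\cdot,\cdot)$ with respect to the free coordinates $(\beta_E,z_{-E})$ on the fiber over $s$.
   Context: For $v\in\mathbb{R}^p$ and $E\subseteq\{1,\dots,p\}$, $v_E$ and $v_{-E}$ denote the subvectors indexed by $E$ and its complement; $\mathrm{sign}$ is applied coordinatewise. $\partial\|\beta\|_1$ is the subdifferential of the $\ell_1$ norm. $(S,\omega)\sim F\times G$ means $S\sim F$ and $\omega\sim G$ independently. *)

(* Defs.v *)
From HB Require Import structures.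
From mathcomp Require Import all_boot all_order all_algebra.
From mathcomp Require Import all_classical all_reals all_analysis.
Set Implicit Arguments. Unset Strict Implicit. Unset Printing Implicit Defensive.
Import Order.TTheory GRing.Theory Num.Theory.
Import numFieldNormedType.Exports.
Local Open Scope classical_set_scope.
Local Open Scope ring_scope.

(* Borel (product) sigma-algebra on R^p, represented as row vectors       *)
(* 'rV[R]_p: generated by the coordinate projections, exactly as the      *)
(* library does for n.-tuple T.                                            *)
Definition rV_measure_display : measure_display -> measure_display.
Proof. exact. Qed.

Section measurable_rV.
Context {d} {T : sigmaRingType d}.
Variable n : nat.

Let coors : 'I_n -> 'rV[T]_n -> T := fun i x => x ord0 i.

Let rV_set0 : g_sigma_preimage coors set0.
Proof. exact: sigma_algebra0. Qed.

Let rV_setC A : g_sigma_preimage coors A -> g_sigma_preimage coors (~` A).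
Proof. exact: sigma_algebraC. Qed.

Let rV_bigcup (F : _^nat) : (forall i, g_sigma_preimage coors (F i)) ->
  g_sigma_preimage coors (\bigcup_i (F i)).
Proof. exact: sigma_algebra_bigcup. Qed.

HB.instance Definition _ := @isMeasurable.Build (rV_measure_display d)
  'rV[T]_n (g_sigma_preimage coors) rV_set0 rV_setC rV_bigcup.

End measurable_rV.

Section defs.
Context {R : realType} {p : nat}.
Local Notation V := 'rV[R]_p.

(* Lebesgue measure on R^p: the measure assigning to every closed box its  *)
(* volume (this determines it uniquely on the Borel sets).                 *)
Definition is_lebesgue_rV (leb : set V -> \bar R) : Prop :=
  forall a b : V, (forall i, a ord0 i <= b ord0 i) ->
    leb [set x : V | forall i, a ord0 i <= x ord0 i <= b ord0 i]
    = (\prod_(i < p) (b ord0 i - a ord0 i))%:E.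

Definition is_density d (T : measurableType d) (mu : set T -> \bar R)
    (f : T -> R) : Prop :=
  [/\ measurable_fun setT f, (forall x, 0 <= f x) &
      (\int[mu]_x (f x)%:E = 1)%E].

Definition norm1 (b : V) : R := \sum_(i < p) `|b ord0 i|.

Definition dotp (u v : V) : R := \sum_(i < p) u ord0 i * v ord0 i.

Definition convex_fun (L : V -> R) : Prop :=
  forall (a b : V) (t : R), 0 <= t <= 1 ->
    L (t *: a + (1 - t) *: b) <= t * L a + (1 - t) * L b.

Definition C2_with_gradient (L : V -> R) (G : V -> V) : Prop :=
  [/\ (forall b, differentiable L b),
      (forall b v, 'D_v L b = dotp (G b) v),
      (forall b, differentiable G b) &
      (forall v, continuous (fun b => 'D_v G b))].

Definition unique_minimizer (F : V -> R) (b : V) : Prop :=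
  (forall c, F b <= F c) /\ (forall b', (forall c, F b' <= F c) -> b' = b).

Definition inB (E : {set 'I_p}) (b z : V) : Prop :=
  [/\ (forall i, i \notin E -> b ord0 i = 0),
      (forall i, i \in E -> Num.sg (b ord0 i) = z ord0 i) &
      (forall i, i \notin E -> `|z ord0 i| < 1)].

(* free coordinates (beta_E, z_{-E}) packed into one vector of R^p *)
Definition packBZ (E : {set 'I_p}) (b z : V) : V :=
  \row_i (if i \in E then b ord0 i else z ord0 i).

Definition betaOf (E : {set 'I_p}) (u : V) : V :=
  \row_i (if i \in E then u ord0 i else 0).
Definition zOf (E : {set 'I_p}) (u : V) : V :=
  \row_i (if i \in E then Num.sg (u ord0 i) else u ord0 i).

Definition psi2 (gam : V -> V) (lam : R) (E : {set 'I_p}) (u : V) : V :=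
  gam (betaOf E u) + lam *: zOf E u.

Definition Jpsi (gam : V -> V) (lam : R) (E : {set 'I_p}) (u : V) : R :=
  `| \det (\matrix_(i < p, j < p)
            ('D_(delta_mx ord0 j) (psi2 gam lam E) u) ord0 i) |.

End defs.

(* Main.v *)
(* Fix s. The KKT conditions say that w is in the selection event exactly when
   w = psi2(u) for some u with |u_i| < 1 off E, and then u is recovered from w by
   packing (bhat_E, zhat_{-E}); so psi2 is injective on this set with measurable
   inverse, and the claim is the change of variables w = psi2(u) followed by
   Tonelli in s. The points u with u_i = 0 for some i in E also satisfy the
   definition of B, but they and their images are null.

   Change of variables. A map with sup-norm Lipschitz constant L multiplies the
   measure of a Borel set by at most L^p: it suffices to compare two measures on
   dyadic cells, whose images sit in boxes. Applied to A and A^-1 through the LU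
   decomposition this gives |A B| = |det A| |B|; unit triangular factors are
   conjugated by diagonal matrices to be arbitrarily close to the identity. A C^1
   map T is locally a perturbation of the identity after composition with
   DT(x)^-1, so the Lipschitz bound, applied both to T and to its inverse, shows
   that |T(B)| and the integral of |det DT| over B agree up to e |B| on small
   cells; no inverse function theorem is needed. Where DT(x) is singular it is
   replaced by a nearby invertible matrix of small determinant. *)
From mathcomp Require Import fingroup perm.
Require Import Defs.
From HB Require Import structures.
From mathcomp Require Import all_boot all_order all_algebra.
From mathcomp Require Import all_classical all_reals all_analysis.
From mathcomp Require Import measurable_realfun ring lra.
Import Order.TTheory GRing.Theory Num.Theory.
Import numFieldNormedType.Exports.
Set Implicit Arguments. Unset Strict Implicit. Unset Printing Implicit Defensive.
Local Open Scope classical_set_scope.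
Local Open Scope ring_scope.

(** * Dyadic cells *)

(** All that is known of [leb] is its value on closed boxes: neither translation invariance nor
    scaling is available at the start. Hence distances are compared coordinate by coordinate, and
    every output coordinate keeps its own Lipschitz constant, so that a diagonal matrix gets its
    exact factor from the first crude estimate. An inequality between two measures is not stable
    under complements, so it is carried from cells to Borel sets by a monotone class argument
    instead of a pi-lambda one. Images of Borel sets are Borel because the left inverse is a
    measurable function on the whole space, built from the estimator itself. The map on a fiber is
    not C^1, as the sign jumps where an active coordinate crosses zero; on each sign pattern it is
    replaced by a C^1 map of the whole space. The mean value theorem is used on cells, which are
    convex, so the set on which the map is injective may be any Borel set. *)

Lemma measurable_rV_coord d (T : sigmaRingType d) n (i : 'I_n) :
  measurable_fun setT (fun x : 'rV[T]_n => x ord0 i).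
Proof.
move=> _ Y mY; rewrite setTI; apply: sub_sigma_algebra => /=.
rewrite -bigcup_seq/=; exists i => /=; first by rewrite mem_index_enum.
by exists Y => //; rewrite setTI.
Qed.

Lemma measurable_fun_rVP d1 d2 (T1 : measurableType d1) (T2 : measurableType d2)
    n (f : T1 -> 'rV[T2]_n) :
  (forall i, measurable_fun setT (fun x => f x ord0 i)) -> measurable_fun setT f.
Proof.
move=> mf.
have : preimage_set_system setT f (\big[setU/set0]_(i < n)
     preimage_set_system setT (fun x : 'rV[T2]_n => x ord0 i) measurable)
   `<=` measurable.
  move=> A [B]; rewrite -bigcup_seq/= => -[i _ [C mC <-]] <-.
  rewrite !setTI -[X in measurable X]setTI; exact: mf.
exact: measurability.
Qed.

Section cells.
Variables (R : realType) (p : nat).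
Local Notation V := 'rV[R]_p.
Implicit Types (n : nat) (x : V) (D : set 'rV[int]_p).

(** The index of the half-open dyadic cube of side 2^-n that contains [x]. As a map into a countable
    type it makes the cells of one level a countable partition by construction. *)
Definition cell n x : 'rV[int]_p := \row_i Num.floor (2 ^+ n * x ord0 i).

Lemma cell_eqP n x (k : 'rV[int]_p) : cell n x = k <->
  forall i, (k ord0 i)%:~R <= 2 ^+ n * x ord0 i < (k ord0 i + 1)%:~R.
Proof.
split=> [<- i|H]; first by rewrite mxE floor_itv.
by apply/rowP => i; rewrite mxE; apply: floor_def.
Qed.

Lemma measurable_cell n D : measurable [set x | D (cell n x)].
Proof.
have -> : [set x | D (cell n x)] =
    \bigcup_k (if `[< D k >] then [set x | cell n x = k] else set0).
  apply/seteqP; split => [x Dx|x [k _]].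
    by exists (cell n x) => //; case: asboolP.
  by case: asboolP => // Dk /= xk; rewrite xk.
apply: countable_bigcupT_measurable; first exact: countableP.
move=> k; case: ifP => // _.
have -> : [set x | cell n x = k] = \bigcap_(i in setT)
   ((fun x : V => x ord0 i) @^-1`
      `[(k ord0 i)%:~R / 2 ^+ n, (k ord0 i + 1)%:~R / 2 ^+ n[).
  apply/seteqP; split => [x /cell_eqP H i _|x H].
    have := H i; rewrite /= in_itv/= ler_pdivrMr ?exprn_gt0// ltr_pdivlMr ?exprn_gt0//.
    by rewrite mulrC.
  apply/cell_eqP => i; have := H i I.
  by rewrite /= in_itv/= ler_pdivrMr ?exprn_gt0// ltr_pdivlMr ?exprn_gt0// mulrC.
apply: fin_bigcap_measurable; first exact: finite_finset.
by move=> i _; rewrite -[X in measurable X]setTI; apply: measurable_rV_coord.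
Qed.

(** Halving the finer index and rounding down gives the coarser one: floor(floor(2y)/2) =
    floor(y). *)
Lemma cell_level_up n x :
  cell n x = \row_i Num.floor (((cell n.+1 x) ord0 i)%:~R / 2 : R).
Proof.
apply/rowP => i; rewrite !mxE; apply/esym/floor_def.
have /andP[a b] := floor_itv (2 ^+ n * x ord0 i).
rewrite ler_pdivlMr// ltr_pdivrMr//.
rewrite -!(intrM _ _ 2) ler_int ltr_int floor_ge_int floor_lt_int !intrM exprS -mulrA.
by rewrite ![2 * (_ * _)]mulrC ler_pM2r// ltr_pM2r// a.
Qed.

Lemma cell_coarsen n m x y : (n <= m)%N -> cell m x = cell m y -> cell n x = cell n y.
Proof.
elim: m => [|m IH]; first by rewrite leqn0 => /eqP ->.
rewrite leq_eqVlt => /predU1P[->//|]; rewrite ltnS => nm xy.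
by apply: IH => //; rewrite cell_level_up xy -cell_level_up.
Qed.

(** Arbitrary, possibly infinite, unions of cells of a single level. Two levels have a common
    refinement, so these sets form a ring. *)
Definition cell_sets : set (set V) :=
  [set A | exists n D, A = [set x | D (cell n x)]].

Lemma cell_sets_lift n m D : (n <= m)%N ->
  exists D', [set x | D (cell n x)] = [set x | D' (cell m x)].
Proof.
move=> nm; exists (fun k => exists2 x, cell m x = k & D (cell n x)).
apply/seteqP; split=> [x Dx|x [y /(cell_coarsen nm) yx Dy]]; first by exists x.
by rewrite /= -yx.
Qed.

Lemma setring_cell_sets : setring cell_sets.
Proof.
split.
- by exists 0%N, set0.
- move=> A B [n [D ->]] [m [D' ->]].
  have [E ->] := cell_sets_lift D (leq_maxl n m).
  have [E' ->] := cell_sets_lift D' (leq_maxr n m).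
  by exists (maxn n m), (E `|` E').
- move=> A B [n [D ->]] [m [D' ->]].
  have [E ->] := cell_sets_lift D (leq_maxl n m).
  have [E' ->] := cell_sets_lift D' (leq_maxr n m).
  by exists (maxn n m), (E `\` E').
Qed.

Lemma dyadic_approx (e : R) : 0 < e -> exists n, 2 ^- n < e.
Proof.
move=> e0; have [n] : exists n, e^-1 < n%:R.
  by exists (Num.truncn e^-1).+1; rewrite truncnS_gt.
exists n; rewrite invf_plt ?posrE ?exprn_gt0//.
by rewrite (lt_trans p0)// -natrX ltr_nat ltn_expl.
Qed.

Lemma measurable_sub_cell_sets : (@measurable _ V) `<=` <<sr cell_sets>>.
Proof.
have srT : sigma_ring <<sr cell_sets>>.
  exact: smallest_sigma_ring.
have [sr0 srD srU] := srT.
have srTT : <<sr cell_sets>> setT.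
  by apply: sub_gen_smallest; exists 0%N, setT.
apply: smallest_sub.
  by split => // A HA; rewrite setTD; rewrite -setTD; exact: srD.
move=> A; rewrite -bigcup_seq/= => -[i _ [B mB <-]].
rewrite setTI.
pose GB := [set B : set R | <<sr cell_sets>> ((fun x : V => x ord0 i) @^-1` B)].
suff : (@measurable _ R) `<=` GB by apply.
have : sigma_algebra setT GB.
  split.
  - by rewrite /GB/= preimage_set0.
  - by move=> C; rewrite /GB/= => HC; rewrite setTD preimage_setC -setTD; exact: srD.
  - by move=> F; rewrite /GB/= => HC; rewrite preimage_bigcup; apply: srU.
move=> sGB.
have -> : (@measurable _ R) = <<s @measurable_realfun.RGenCInfty.G R>>.
  exact: measurable_realfun.RGenCInfty.measurableE.
apply: smallest_sub => // _ [r ->].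
rewrite /GB/=.
(* A point has i-th coordinate below r exactly when, at some level, its whole cell lies to the left
   of r in direction i. *)
have -> : (fun x : V => x ord0 i) @^-1` `[r, +oo[ =
    setT `\` \bigcup_n [set x | ((cell n x ord0 i) + 1)%:~R <= 2 ^+ n * r].
  rewrite setTD; apply/seteqP; split => x /=; rewrite in_itv/= andbT.
    move=> rx [n _]/=; rewrite mxE => H.
    have := floorD1_gt (2 ^+ n * x ord0 i) => /lt_le_trans/(_ H).
    by rewrite ltr_pM2l ?exprn_gt0// ltNge rx.
  move=> H; rewrite leNgt; apply/negP => xr; apply: H.
  have /dyadic_approx[n Hn] : 0 < r - x ord0 i by rewrite subr_gt0.
  exists n => //=; rewrite mxE intrD1 (le_trans (lerD (floor_le _) (lexx _)))//.
  rewrite -lerBrDl -mulrBr -ler_pdivrMl ?exprn_gt0// mulr1 ltW//.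
apply: srD => //; apply: srU => n; apply: sub_gen_smallest.
by exists n, [set k | (k ord0 i + 1)%:~R <= 2 ^+ n * r].
Qed.

End cells.

(** * Comparison of two measures through dyadic cells *)

Section comparison.
Variables (R : realType) (p : nat).
Local Notation V := 'rV[R]_p.
Local Open Scope ereal_scope.

(** Sigma-additivity over the fibers of [key], numbered by [pickle]; the measures may be
    infinite. *)
Lemma le_measure_fibers d (T : measurableType d) (I : countType) (key : T -> I)
    (mu1 mu2 : {measure set T -> \bar R}) (B : set T) :
  (forall i, measurable [set x | key x = i]) -> measurable B ->
  (forall i, mu1 (B `&` [set x | key x = i]) <= mu2 (B `&` [set x | key x = i])) ->
  mu1 B <= mu2 B.
Proof.
move=> mkey mB le12.
pose F n := B `&` [set x | pickle (key x) = n].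
have mF n : measurable (F n).
  apply: measurableI => //; case: (pselect (exists i : I, pickle i = n)) => [[i <-]|ni].
    rewrite (_ : mkset _ = [set x | key x = i])//; apply/seteqP; split => x /=; last by move=> ->.
    by move/(pcan_inj pickleK).
  rewrite (_ : mkset _ = set0)//; apply/seteqP; split => x //= xn.
  by apply: ni; exists (key x).
have BE : B = \bigcup_n F n.
  apply/seteqP; split=> [x Bx|x [n _ []]//].
  by exists (pickle (key x)).
have tF : trivIset setT F.
  by apply/trivIsetP => i j _ _ ij; apply/seteqP; split=> x //= [[_ /= e1] [_ /= e2]]; move: ij; rewrite -e1 -e2 eqxx.
rewrite BE !measure_bigcup//; apply: lee_nneseries => // n _.
case: (pselect (exists i : I, pickle i = n)) => [[i <-]|ni].
  rewrite (_ : F _ = B `&` [set x | key x = i])//; congr (_ `&` _).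
  by apply/seteqP; split => x /=; [move/(pcan_inj pickleK)|move=> ->].
rewrite (_ : F n = set0) ?measure0//; apply/seteqP; split => x //= [_ /= xn].
by apply: ni; exists (key x).
Qed.

(** The sets satisfying the inequality form a monotone class containing the ring [cell_sets].
    Finiteness provides continuity along decreasing sequences. *)
Lemma le_measure_cells (mu1 mu2 : {measure set V -> \bar R}) :
  mu1 setT < +oo -> mu2 setT < +oo ->
  (forall n k, mu1 [set x | cell n x = k] <= mu2 [set x | cell n x = k]) ->
  forall B, measurable B -> mu1 B <= mu2 B.
Proof.
move=> fin1 fin2 le12 B mB.
pose G := [set B : set V | measurable B /\ mu1 B <= mu2 B].
suff : <<sr @cell_sets R p>> `<=` G by move/(_ _ (measurable_sub_cell_sets mB)) => -[].
apply: monotone_setring_sub_g_sigma_ring; last 2 first.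
- exact: setring_cell_sets.
- move=> _ [n [D ->]]; split; first exact: measurable_cell.
  apply: (@le_measure_fibers _ _ _ (@cell R p n)) => [k||k].
  + exact: (measurable_cell n [set k]).
  + exact: measurable_cell.
  + case: (pselect (D k)) => Dk.
      rewrite (_ : _ `&` _ = [set x | cell n x = k])//.
      by apply/seteqP; split=> x /= => [[]//|xk]; split=> //; rewrite xk.
    rewrite (_ : _ `&` _ = set0) ?measure0//.
    by apply/seteqP; split=> x //= [Dx xk]; apply: Dk; rewrite -xk.
have fin (mu : {measure set V -> \bar R}) A : mu setT < +oo -> measurable A -> mu A < +oo.
  move=> h mA; apply: le_lt_trans h; apply: le_measure => //; rewrite ?inE//.
split.
- move=> F ndF GF; have mF i : measurable (F i) by case: (GF i).
  have mUF : measurable (\bigcup_i F i) by exact: bigcupT_measurable.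
  split=> //.
  have c1 := nondecreasing_cvg_mu (mu := mu1) mF mUF ndF.
  have c2 := nondecreasing_cvg_mu (mu := mu2) mF mUF ndF.
  rewrite -(cvg_lim _ c1)// -(cvg_lim _ c2)//; apply: lee_lim; [exact: cvgP c1|exact: cvgP c2|].
  by near=> n; case: (GF n).
- move=> F ndF GF; have mF i : measurable (F i) by case: (GF i).
  have mUF : measurable (\bigcap_i F i) by exact: bigcapT_measurable.
  split=> //.
  have c1 := nonincreasing_cvg_mu (mu := mu1) (fin _ _ fin1 (mF 0%N)) mF mUF ndF.
  have c2 := nonincreasing_cvg_mu (mu := mu2) (fin _ _ fin2 (mF 0%N)) mF mUF ndF.
  rewrite -(cvg_lim _ c1)// -(cvg_lim _ c2)//; apply: lee_lim; [exact: cvgP c1|exact: cvgP c2|].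
  by near=> n; case: (GF n).
Unshelve. all: by end_near. Qed.

(* Partition X into the maximal cells on which the comparison is known. *)
Lemma le_measure_locally (mu1 mu2 : {measure set V -> \bar R}) (X : set V) :
  measurable X ->
  (forall x, X x -> exists n, forall B, measurable B -> B `<=` X ->
     B `<=` [set y | cell n y = cell n x] -> mu1 B <= mu2 B) ->
  forall B, measurable B -> B `<=` X -> mu1 B <= mu2 B.
Proof.
move=> mX loc B mB BX.
pose good n (k : 'rV[int]_p) := forall B, measurable B -> B `<=` X ->
     B `<=` [set y | cell n y = k] -> mu1 B <= mu2 B.
have exg x : exists n, X x -> good n (cell n x).
  by have [Xx|] := pselect (X x); [have [n] := loc x Xx; exists n|exists 0%N].
pose gb (x : V) n := `[< good n (cell n x) >].
(* Points outside X accept every level, so that the least admissible level is defined everywhere. *)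
have exgb (x : V) : exists n, gb x n || ~~ `[< X x >].
  have [n gn] := exg x; exists n; have [Xx|] := asboolP (X x); last by rewrite orbT.
  by rewrite orbF; apply/asboolP/gn.
pose lev (x : V) := ex_minn (exgb x).
have levP n x : X x -> (lev x == n) = gb x n && [forall m : 'I_n, ~~ gb x m].
  move=> Xx; rewrite /lev; case: ex_minnP => m; rewrite asboolT// orbF => gm minm.
  apply/eqP/andP => [<-|[gn /forallP nn]].
    split=> //; apply/forallP => i; apply/negP => gi.
    by have := minm i; rewrite gi => /(_ isT); rewrite leqNgt ltn_ord.
  apply/eqP; rewrite eqn_leq minm ?gn// leqNgt; apply/negP => mn.
  by have := nn (Ordinal mn); rewrite /= gm.
have good_meas n : measurable [set x | gb x n].
  exact: (measurable_cell n [set k | `[< good n k >]]).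
have lev_meas n : measurable [set x | gb x n && [forall m : 'I_n, ~~ gb x m]].
  rewrite (_ : mkset _ = [set x | gb x n] `&` \bigcap_(m in `I_n) ~` [set x | gb x m]).
    apply: measurableI => //; apply: bigcap_measurableType => m _; exact: measurableC.
  apply/seteqP; split=> x /=.
    case/andP => -> /forallP nn; split=> // m mn; apply/negP; exact: (nn (Ordinal mn)).
  by move=> [-> nn]; apply/forallP => i; apply/negP/(nn i)/ltn_ord.
have : mu1 (B `&` X) <= mu2 (B `&` X); last by rewrite (setIidl BX).
(* Each [Some] fiber lies in one good cell; [None] collects the complement of X, which [B] does not
   meet. *)
pose key (x : V) := if `[< X x >] then Some (lev x, cell (lev x) x) else None.
have mkey i : measurable [set x | key x = i].
  case: i => [[n k]|].
    rewrite (_ : mkset _ = X `&` [set x | gb x n && [forall m : 'I_n, ~~ gb x m]]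
        `&` [set x | cell n x = k]).
      by apply: measurableI; [exact: measurableI|exact: (measurable_cell n [set k])].
    apply/seteqP; split=> x /=; rewrite /key; case: asboolP => // Xx.
    - by case=> <- <-; split => //; split=> //; rewrite -levP.
    - by move=> [[_]]; rewrite -levP// => /eqP <- <-.
    - by move=> [[]].
  rewrite (_ : mkset _ = ~` X); first exact: measurableC.
  by apply/seteqP; split=> x /=; rewrite /key; case: asboolP.
apply: (@le_measure_fibers _ _ _ key) => //; first exact: measurableI.
move=> [[n k]|]; last first.
  rewrite (_ : _ `&` _ = set0) ?measure0//; apply/seteqP; split=> x //= [[_ Xx]].
  by rewrite /key asboolT.
set A := _ `&` _.
have [->|/set0P[x]] := eqVneq A set0; first by rewrite !measure0.
rewrite /A/= => -[[Bx Xx]]; rewrite /key asboolT//= => -[xn xk].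
have : good n k.
  have := levP n x Xx; rewrite xn eqxx => /esym/andP[/asboolP + _].
  by rewrite -xn xk xn.
apply.
- by apply: measurableI; [exact: measurableI|exact: mkey].
- by move=> y [[]].
- by move=> y [[_ Xy]] /=; rewrite asboolT//= => -[-> ->].
Qed.

End comparison.

(** * Images of Borel sets under Lipschitz maps *)

Lemma measurable_eq_rV d (S : measurableType d) (R : realType) (p : nat)
    (f g : S -> 'rV[R]_p) : measurable_fun setT f ->
  measurable_fun setT g -> measurable [set x | f x = g x].
Proof.
move=> mf mg.
rewrite (_ : mkset _ =
  \bigcap_(i in @setT 'I_p) [set x | (f x ord0 i == g x ord0 i) = true]).
  apply: fin_bigcap_measurable; first exact: finite_finset.
  move=> i _; rewrite -[X in measurable X]setTI.
  have := @measurable_fun_eqr _ _ _ setT (fun x => f x ord0 i) (fun x => g x ord0 i).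
  move=> /(_ _ _ measurableT [set true]); apply => //.
  - exact: (measurableT_comp (measurable_rV_coord i) mf).
  - exact: (measurableT_comp (measurable_rV_coord i) mg).
apply/seteqP; split => x /= H; first by move=> i _; rewrite /= H eqxx.
by apply/rowP => i; apply/eqP/H.
Qed.

Section image_measure.
Variables (R : realType) (p : nat).
Local Notation V := 'rV[R]_p.
Variables (T Th : V -> V) (X : set V).
Hypotheses (mT : measurable_fun setT T) (mTh : measurable_fun setT Th).
Hypotheses (mX : measurable X) (ThT : forall x, X x -> Th (T x) = x).

(** Turns a direct image, which need not be Borel in general, into a preimage under [Th] cut by a
    measurable equation. *)
Lemma image_inverseE (B : set V) :
  T @` (B `&` X) = Th @^-1` (B `&` X) `&` [set w | T (Th w) = w].
Proof.
apply/seteqP; split => [_ [x [Bx Xx] <-]|w [[Bw Xw] Tw]] /=.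
  by rewrite ThT.
by exists (Th w).
Qed.

Lemma measurable_image (B : set V) : measurable B -> measurable (T @` (B `&` X)).
Proof.
move=> mB; rewrite image_inverseE; apply: measurableI.
  rewrite -[X in measurable X]setTI; apply: mTh => //; exact: measurableI.
by apply: measurable_eq_rV => //; exact: measurableT_comp.
Qed.

Lemma image_measure_exists (mu : {measure set V -> \bar R}) :
  exists nu : {measure set V -> \bar R},
    forall B, measurable B -> nu B = mu (T @` (B `&` X)).
Proof.
have mTX : measurable (T @` X) by rewrite -[X]setTI; exact: measurable_image.
unshelve eexists (pushforward (mrestr mu mTX) Th : {measure set V -> \bar R}) => //.
move=> B mB; rewrite /pushforward /mrestr; congr (mu _).
rewrite -{1}[X]setTI !image_inverseE.
by apply/seteqP; split => w /=; [move=> [? [[]]]|move=> [[]]].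
Qed.

End image_measure.

Lemma expr_onem_ge (R : realDomainType) (c : R) n : 0 <= c <= 1 -> 1 - n%:R * c <= (1 - c) ^+ n.
Proof.
move=> /andP[c0 c1]; elim: n => [|n IH]; first by rewrite mul0r subr0 expr0.
apply: (@le_trans _ _ ((1 - c) * (1 - n%:R * c))); last first.
  by rewrite exprS ler_wpM2l// subr_ge0.
rewrite -natr1; have : 0 <= n%:R :> R by []; nra.
Qed.

Section lebesgue.
Variables (R : realType) (p : nat).
Local Notation V := 'rV[R]_p.
Variable leb : {measure set V -> \bar R}.
Hypothesis Hleb : is_lebesgue_rV leb.

Lemma measurable_box (a b : V) :
  measurable [set x : V | forall i, a ord0 i <= x ord0 i <= b ord0 i].
Proof.
rewrite (_ : mkset _ = \bigcap_(i in @setT 'I_p)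
    ((fun x : V => x ord0 i) @^-1` `[a ord0 i, b ord0 i])).
  apply: fin_bigcap_measurable; first exact: finite_finset.
  by move=> i _; rewrite -[X in measurable X]setTI; apply: measurable_rV_coord.
apply/seteqP; split => x /= H; first by move=> i _; rewrite /= in_itv/=; exact: H.
by move=> i; have := H i I; rewrite /= in_itv.
Qed.

Lemma ler_onemX_lim (a b : R) n : 0 <= a ->
  (forall e, 0 < e < 1 -> (1 - e) ^+ n * a <= b) -> a <= b.
Proof.
move=> a0 H; apply/ler_addgt0Pr => d d0.
(* By Bernoulli the factor (1 - e)^n costs at most n e a, which this choice keeps below d. *)
pose e := Num.min (2^-1) (d / (n%:R * a + 1)).
have k0 : 0 < n%:R * a + 1 by rewrite ltr_wpDl// mulr_ge0.
have e0 : 0 < e by rewrite lt_min invr_gt0 ltr0n/= divr_gt0.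
have e1 : e < 1 by rewrite gt_min invf_lt1// ltr1n.
have := H e; rewrite e0 e1 => /(_ isT) le_b.
have bern : 1 - n%:R * e <= (1 - e) ^+ n by rewrite expr_onem_ge// !ltW.
have le_a : a - n%:R * e * a <= b.
  by apply: le_trans le_b; rewrite -[X in X - _]mul1r -mulrBl ler_wpM2r ?bern.
have ed : e * (n%:R * a + 1) <= d by rewrite -ler_pdivlMr// ge_min lexx orbT.
have : n%:R * e * a <= d.
  by apply: le_trans ed; rewrite mulrDr mulr1 mulrCA mulrA lerDl ltW.
by lra.
Qed.

Lemma leb_cell_le n k : (leb [set x | cell n x = k] <= ((2 ^- n) ^+ p)%:E)%E.
Proof.
pose a : V := \row_i ((k ord0 i)%:~R / 2 ^+ n).
pose b : V := \row_i ((k ord0 i + 1)%:~R / 2 ^+ n).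
have <- : leb [set x : V | forall i, a ord0 i <= x ord0 i <= b ord0 i] = ((2 ^- n) ^+ p)%:E.
  rewrite Hleb => [|i]; last by rewrite !mxE ler_pM2r ?invr_gt0 ?exprn_gt0// ler_int lerDl.
  rewrite (eq_bigr (fun=> 2 ^- n)) => [|i _]; last by rewrite !mxE intrD1; ring.
  by rewrite prodr_const card_ord.
apply: le_measure; rewrite ?inE.
- exact: (measurable_cell n [set k]).
- exact: measurable_box.
- move=> x /= /cell_eqP H i; have /andP[h1 h2] := H i.
  by rewrite !mxE ler_pdivrMr ?exprn_gt0// ler_pdivlMr ?exprn_gt0// mulrC h1 ltW.
Qed.

(** Volumes are given for closed boxes, whereas the cell is half-open: it is exhausted from inside
    by closed boxes of side (1 - e) 2^-n with the same lower corner. *)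
Lemma leb_cell_ge n k : (((2 ^- n) ^+ p)%:E <= leb [set x | cell n x = k])%E.
Proof.
have fin : leb [set x | cell n x = k] \is a fin_num.
  by rewrite ge0_fin_numE// (le_lt_trans (leb_cell_le n k))// ltry.
rewrite -(fineK fin) lee_fin; apply: (@ler_onemX_lim _ _ p) => [|e /andP[e0 e1]].
  by rewrite exprn_ge0// invr_ge0 exprn_ge0.
rewrite -exprMn -lee_fin (fineK fin).
pose a : V := \row_i ((k ord0 i)%:~R / 2 ^+ n).
pose b : V := \row_i ((k ord0 i)%:~R / 2 ^+ n + (1 - e) * 2 ^- n).
have <- : leb [set x : V | forall i, a ord0 i <= x ord0 i <= b ord0 i] =
    (((1 - e) * 2 ^- n) ^+ p)%:E.
  rewrite Hleb => [|i]; last first.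
    by rewrite !mxE lerDl mulr_ge0 ?subr_ge0 ?ltW// invr_ge0 exprn_ge0.
  rewrite (eq_bigr (fun=> (1 - e) * 2 ^- n)) => [|i _]; last by rewrite !mxE addrAC subrr add0r.
  by rewrite prodr_const card_ord.
apply: le_measure; rewrite ?inE.
- exact: measurable_box.
- exact: (measurable_cell n [set k]).
- move=> x /= H; apply/cell_eqP => i; have /andP[] := H i; rewrite !mxE.
  rewrite ler_pdivrMr ?exprn_gt0// mulrC => -> /=.
  rewrite -mulrDl ler_pdivlMr ?exprn_gt0// mulrC => /le_lt_trans; apply.
  by rewrite intrD1; lra.
Qed.

Section image_le.
Variables (T Th : V -> V) (X : set V).
Hypotheses (mT : measurable_fun setT T) (mTh : measurable_fun setT Th).
Hypotheses (mX : measurable X) (ThT : forall x, X x -> Th (T x) = x).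

(** A Lipschitz condition for the sup distance with one constant per output coordinate; the bound
    [r] stands for the distance and avoids naming a norm. *)
Local Notation modulus L := (forall x y, X x -> X y -> forall r : R,
  (forall j, `|x ord0 j - y ord0 j| <= r) ->
  forall i, `|T x ord0 i - T y ord0 i| <= L i * r).

(* An image of a cell sits in the box spanned by the coordinatewise extrema. *)
Lemma leb_image_cell_le (L : 'I_p -> R) n k : (forall i, 0 <= L i) -> modulus L ->
  (leb (T @` ([set x | cell n x = k] `&` X)) <=
   (\prod_i L i)%:E * leb [set x | cell n x = k])%E.
Proof.
move=> L0 lip; set Q := [set x | _].
have K0 : 0 <= \prod_i L i by exact: prodr_ge0.
have [QX0|/set0P[x0 [Qx0 Xx0]]] := eqVneq (Q `&` X) set0.
  by rewrite QX0 image_set0 measure0 mule_ge0.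
have diam x y : Q x -> Q y -> forall j, `|x ord0 j - y ord0 j| <= 2 ^- n.
  move=> /cell_eqP qx /cell_eqP qy j; have /andP[x1 x2] := qx j; have /andP[y1 y2] := qy j.
  have n0 : 0 < 2 ^+ n :> R by rewrite exprn_gt0.
  rewrite -[X in _ <= X]mul1r ler_pdivlMr// -[X in _ * X](gtr0_norm n0) -normrM mulrBl.
  by rewrite !(mulrC _ (2 ^+ n)) ler_norml; move: x1 x2 y1 y2; rewrite intrD1; lra.
pose I i := [set T x ord0 i | x in Q `&` X].
have bd i x y : (Q `&` X) x -> (Q `&` X) y -> T x ord0 i - T y ord0 i <= L i * 2 ^- n.
  move=> [Qx Xx] [Qy Xy]; apply: le_trans (ler_norm _) _; apply: lip => //; exact: diam.
have I0 i : I i !=set0 by exists (T x0 ord0 i), x0.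
have Iub i : has_ubound (I i).
  exists (T x0 ord0 i + L i * 2 ^- n) => _ [x QXx <-].
  by rewrite -lerBlDl; exact: bd.
have Ilb i : has_lbound (I i).
  exists (T x0 ord0 i - L i * 2 ^- n) => _ [x QXx <-].
  by rewrite lerBlDr -lerBlDl; exact: bd.
pose a : V := \row_i inf (I i); pose b : V := \row_i sup (I i).
have ab i : a ord0 i <= b ord0 i.
  by rewrite !mxE; apply: (@le_trans _ _ (T x0 ord0 i)); [apply: ge_inf|apply: ub_le_sup] => //; exists x0.
have ab_le i : b ord0 i - a ord0 i <= L i * 2 ^- n.
  rewrite !mxE lerBlDr; apply: ge_sup => // _ [x QXx <-].
  rewrite -lerBlDl; apply: lb_le_inf => // _ [y QXy <-].
  by rewrite lerBlDl -lerBlDr; exact: bd.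
apply: (@le_trans _ _ (leb [set x : V | forall i, a ord0 i <= x ord0 i <= b ord0 i])).
  apply: le_measure; rewrite ?inE; last 1 first.
  - move=> _ [x QXx <-] i; rewrite !mxE.
    by apply/andP; split; [apply: ge_inf|apply: ub_le_sup] => //; exists x.
  - by apply: (measurable_image mT mTh) => //; exact: (measurable_cell n [set k]).
  - exact: measurable_box.
rewrite Hleb//; apply: (@le_trans _ _ (\prod_i (L i * 2 ^- n))%:E).
  by rewrite lee_fin; apply: ler_prod => i _; rewrite subr_ge0 ab ab_le.
rewrite big_split/= prodr_const card_ord EFinM lee_wpmul2l// ?lee_fin//.
exact: leb_cell_ge.
Qed.

Lemma leb_image_le (L : 'I_p -> R) : (forall i, 0 <= L i) -> modulus L ->
  (leb (T @` X) <= (\prod_i L i)%:E * leb X)%E.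
Proof.
move=> L0 lip.
have K0 : 0 <= \prod_i L i by exact: prodr_ge0.
have [nu nuE] := image_measure_exists mT mTh mX ThT leb.
pose K := NngNum K0.
have -> : leb (T @` X) = nu X by rewrite nuE// setIid.
suff : (nu X <= mscale K leb X)%E by [].
(* Localizing at level 0 confines the comparison to a unit cell, where both measures are finite, as
   [le_measure_cells] requires. *)
apply: (@le_measure_locally _ _ _ _ setT) => //.
move=> x _; exists 0%N => B mB _ BQ.
set Q := [set y | _] in BQ.
have mQ : measurable Q by exact: (measurable_cell 0 [set cell 0 x]).
have leQ n k : (nu [set x | cell n x = k] <= mscale K leb [set x | cell n x = k])%E.
  rewrite nuE; last exact: (measurable_cell n [set k]).
  exact: leb_image_cell_le.
have : (mrestr nu mQ B <= mrestr (mscale K leb) mQ B)%E.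
  apply: le_measure_cells => //.
  - rewrite /= /mrestr setTI (le_lt_trans (leQ _ _))// /mscale/= lte_mul_pinfty//.
    by rewrite (le_lt_trans (leb_cell_le _ _))// ltry.
  - rewrite /= /mrestr setTI /mscale/= lte_mul_pinfty//.
    by rewrite (le_lt_trans (leb_cell_le _ _))// ltry.
  - move=> n k; rewrite /= /mrestr.
    (* A cell of level n >= 0 is either disjoint from the level-0 cell Q or contained in it. *)
    set A := _ `&` Q; have [->|/set0P[y [/= yk yQ]]] := eqVneq A set0; first by rewrite !measure0.
    rewrite (_ : A = [set x | cell n x = k])//; apply/seteqP; split => [z []//|z /= zk].
    split=> //=; rewrite /Q/= -yQ; apply: (@cell_coarsen _ _ 0 n) => //.
    by rewrite yk zk.
by rewrite /mrestr (setIidl BQ).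
Qed.

End image_le.

End lebesgue.

(** * Linear maps *)

Section linear_maps.
Variables (R : realType) (p : nat).
Local Notation V := 'rV[R]_p.
Variable leb : {measure set V -> \bar R}.
Hypothesis Hleb : is_lebesgue_rV leb.

Lemma measurable_mulmxr (A : 'M[R]_p) : measurable_fun setT (fun x : V => x *m A).
Proof.
apply: measurable_fun_rVP => j.
under eq_fun do rewrite mxE.
apply: measurable_sum => i; apply: measurable_funM; last exact: measurable_cst.
exact: measurable_rV_coord.
Qed.

Lemma measurable_image_mulmxr (A : 'M[R]_p) (B : set V) : A \in unitmx ->
  measurable B -> measurable ((fun x : V => x *m A) @` B).
Proof.
move=> uA mB; rewrite -[B]setTI setIC.
apply: (measurable_image (measurable_mulmxr A) (measurable_mulmxr (invmx A))) => // x _.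
by rewrite mulmxK.
Qed.

Lemma image_mulmxr_comp (A A' : 'M[R]_p) (B : set V) :
  (fun x : V => x *m (A *m A')) @` B =
  (fun x : V => x *m A') @` ((fun x : V => x *m A) @` B).
Proof.
apply/seteqP; split => [_ [x Bx <-]|_ [_ [x Bx <-] <-]].
  by exists (x *m A); [exists x|rewrite mulmxA].
by exists x => //; rewrite mulmxA.
Qed.

Lemma le_norm_mulmx_coord (A : 'M[R]_p) (u : V) (r : R) :
  (forall j, `|u ord0 j| <= r) ->
  forall j, `|(u *m A) ord0 j| <= (\sum_i `|A i j|) * r.
Proof.
move=> ur j; rewrite mxE (le_trans (ler_norm_sum _ _ _))// mulr_suml.
by apply: ler_sum => i _; rewrite normrM mulrC ler_wpM2l.
Qed.

(** The j-th column sum is a Lipschitz constant of the j-th output coordinate. The bound equals |det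
    A| when every column has a single nonzero entry in its own row, that is for diagonal and
    permutation matrices. *)
Lemma leb_mulmxr_colsum (A : 'M[R]_p) (B : set V) : A \in unitmx -> measurable B ->
  (leb ((fun x : V => (x *m A)%R) @` B) <= (\prod_j \sum_i `|A i j|)%:E * leb B)%E.
Proof.
move=> uA mB.
apply: (leb_image_le Hleb (measurable_mulmxr A) (measurable_mulmxr (invmx A))) => //.
- by move=> x _; rewrite mulmxK.
- by move=> j; apply: sumr_ge0.
- move=> x y _ _ r xyr j.
  rewrite (_ : _ - _ = ((x - y) *m A) ord0 j); last by rewrite mulmxBl !mxE.
  by apply: le_norm_mulmx_coord => i; rewrite !mxE.
Qed.

(** Only an upper bound, because it is closed under products; equality will follow by applying it to
    the inverse matrix. *)
Let good (A : 'M[R]_p) := A \in unitmx /\ forall B : set V, measurable B ->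
  (leb ((fun x : V => (x *m A)%R) @` B) <= (`|\det A|)%:E * leb B)%E.

Let good_mul A A' : good A -> good A' -> good (A *m A').
Proof.
move=> [uA gA] [uA' gA']; split=> [|B mB]; first by rewrite unitmx_mul uA.
rewrite image_mulmxr_comp.
rewrite (le_trans (gA' _ (measurable_image_mulmxr uA mB)))//.
rewrite det_mulmx normrM mulrC EFinM -muleA lee_wpmul2l//.
exact: gA.
Qed.

Let good_diag (d : V) : (forall i, d ord0 i != 0) -> good (diag_mx d).
Proof.
move=> d0; have u : diag_mx d \in unitmx.
  by rewrite unitmxE det_diag unitfE; apply/prodf_neq0 => i _; exact: d0.
split=> // B mB; rewrite (le_trans (leb_mulmxr_colsum u mB))//.
rewrite det_diag normr_prod lee_wpmul2r// lee_fin le_eqVlt; apply/orP; left; apply/eqP.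
apply: eq_bigr => j _; rewrite (bigD1 j)//= big1 ?addr0 ?mxE ?eqxx ?mulr1n// => i ij.
by rewrite mxE (negbTE ij) mulr0n normr0.
Qed.

Let good_perm (s : {perm 'I_p}) : good (perm_mx s).
Proof.
have u : perm_mx s \in @unitmx R p by exact: unitmx_perm.
split=> // B mB; rewrite (le_trans (leb_mulmxr_colsum u mB))//.
rewrite det_perm normrX normrN1 expr1n lee_wpmul2r// lee_fin le_eqVlt; apply/orP; left; apply/eqP.
apply: big1 => j _; rewrite (bigD1 ((s^-1)%g j))//= big1 ?addr0 => [|i ij].
  by rewrite !mxE permKV eqxx normr1.
rewrite !mxE (_ : (s i == j) = false) ?normr0//.
by apply/negbTE; apply: contra ij => /eqP <-; rewrite permK.
Qed.

(* Conjugating by diag(t^(w i)) multiplies the off-diagonal entries by positive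
   powers of t, so the column sums tend to 1 as t -> 0. *)
Let good_unitriangular (w : 'I_p -> nat) (L : 'M[R]_p) : \det L = 1 ->
  (forall i, L i i = 1) -> (forall i j, i != j -> L i j != 0 -> (w j < w i)%N) -> good L.
Proof.
move=> detL Lii Lij; have u : L \in unitmx by rewrite unitmxE detL unitr1.
split=> // B mB; rewrite detL normr1 mul1e.
(* The limit t -> 0 is taken on real numbers, so infinite measure is set apart. *)
have [->|finB] := eqVneq (leb B) +oo%E; first by rewrite leey.
have {}finB : leb B \is a fin_num by rewrite ge0_fin_numE// ltey.
pose S := \sum_i \sum_j `|L i j|.
have S0 : 0 <= S by apply: sumr_ge0 => i _; apply: sumr_ge0.
have bound (t : R) : 0 < t -> t < 1 ->
    (leb ((fun x : V => (x *m L)%R) @` B) <= ((1 + t * S) ^+ p)%:E * leb B)%E.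
  move=> t0 t1.
  pose D := diag_mx (\row_i t ^+ w i); pose D' := diag_mx (\row_i t ^- w i).
  have gD : good D by apply: good_diag => i; rewrite mxE expf_neq0// gt_eqF.
  have gD' : good D' by apply: good_diag => i; rewrite mxE invr_neq0// expf_neq0// gt_eqF.
  have D'D : D' *m D = 1%:M.
    rewrite mulmx_diag -diag_const_mx; congr diag_mx; apply/rowP => i.
    by rewrite !mxE mulVf// expf_neq0// gt_eqF.
  have DD' : D *m D' = 1%:M by exact: mulmx1C.
  pose M := D *m L *m D'.
  have ME i j : M i j = t ^+ w i * L i j / t ^+ w j.
    by rewrite /M mul_mx_diag mxE mul_diag_mx !mxE.
  have uM : M \in unitmx by rewrite !unitmx_mul u (proj1 gD) (proj1 gD').
  have LE : L = D' *m M *m D by rewrite /M !mulmxA D'D mul1mx -mulmxA D'D mulmx1.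
  pose B1 := (fun x : V => x *m D') @` B.
  have mB1 : measurable B1 by apply: measurable_image_mulmxr => //; exact: (proj1 gD').
  pose B2 := (fun x : V => x *m M) @` B1.
  have mB2 : measurable B2 by exact: measurable_image_mulmxr.
  rewrite (_ : _ @` B = (fun x : V => x *m D) @` B2); last first.
    by rewrite {1}LE (image_mulmxr_comp (D' *m M) D) (image_mulmxr_comp D' M).
  rewrite (le_trans (proj2 gD _ mB2))//.
  have : (leb B2 <= ((1 + t * S) ^+ p)%:E * leb B1)%E.
    rewrite (le_trans (leb_mulmxr_colsum uM mB1))// lee_wpmul2r// lee_fin.
    rewrite -[X in _ <= _ ^+ X]card_ord -prodr_const; apply: ler_prod => j _.
    rewrite sumr_ge0//= (bigD1 j)//= ME Lii mulr1 divff ?expf_neq0 ?gt_eqF// normr1 lerD2l.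
    apply: (@le_trans _ _ (t * \sum_(i | i != j) `|L i j|)); last first.
      rewrite ler_wpM2l ?(ltW t0)// /S exchange_big/= [X in _ <= X](bigD1 j)//=.
      rewrite [X in _ <= X + _](bigD1 j)//= -addrA addrCA lerDl addr_ge0//.
      by apply: sumr_ge0 => i _; exact: sumr_ge0.
    rewrite mulr_sumr.
    apply: ler_sum => i ij; rewrite ME.
    have [->|Lij0] := eqVneq (L i j) 0; first by rewrite mulr0 mul0r normr0 mulr0.
    have wij := Lij _ _ ij Lij0.
    rewrite mulrAC -expfB// normrM ler_wpM2r// ger0_norm; last by rewrite exprn_ge0// ltW.
    rewrite -[X in _ <= X]expr1; apply: ler_wiXn2l; [exact: ltW|exact: ltW|].
    by rewrite subn_gt0.
  have dD0 : (0 <= (`|\det D|)%:E)%E by rewrite lee_fin.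
  move=> /(lee_wpmul2l dD0) /le_trans; apply; rewrite muleCA lee_wpmul2l//.
    by rewrite lee_fin exprn_ge0// addr_ge0// mulr_ge0// ltW.
  have := lee_wpmul2l dD0 (proj2 gD' _ mB).
  by rewrite muleA -EFinM -normrM -det_mulmx DD' det1 normr1 mul1e.
have fin1 : leb ((fun x : V => (x *m L)%R) @` B) \is a fin_num.
  rewrite ge0_fin_numE// (le_lt_trans (bound 2^-1 _ _)) ?invr_gt0 ?invf_lt1 ?ltr1n//.
  by rewrite lte_mul_pinfty ?lee_fin ?exprn_ge0 ?addr_ge0 ?mulr_ge0 ?invr_ge0// -ge0_fin_numE.
rewrite -(fineK fin1) -(fineK finB) lee_fin; apply: (@ler_onemX_lim _ _ _ p).
  exact: fine_ge0.
move=> e /andP[e0 e1]; have k0 : 0 < 1 + S by rewrite ltr_wpDr.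
(* For t = e / (1 + S) one has t S <= e, hence (1 - e)(1 + t S) <= 1 - e^2 <= 1. *)
have t0 : 0 < e / (1 + S) by rewrite divr_gt0.
have t1 : e / (1 + S) < 1 by rewrite ltr_pdivrMr// mul1r (lt_le_trans e1)// lerDl.
have := bound _ t0 t1; rewrite -(fineK fin1) -(fineK finB) -EFinM lee_fin => H.
apply: (@le_trans _ _ ((1 - e) ^+ p * ((1 + e / (1 + S) * S) ^+ p * fine (leb B)))).
  by rewrite ler_wpM2l// exprn_ge0// subr_ge0 ltW.
have tS : e / (1 + S) * S <= e.
  by rewrite mulrAC ler_pdivrMr// ler_wpM2l ?lerDr// ltW.
rewrite mulrA -exprMn -[X in _ <= X]mul1r ler_wpM2r ?fine_ge0//.
have tS0 : 0 <= e / (1 + S) * S by rewrite mulr_ge0// ltW.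
apply: exprn_ile1; first by apply: mulr_ge0; [lra|exact: addr_ge0].
set c := e / (1 + S) * S in tS tS0 *; nra.
Qed.

Let good_upper (U : 'M[R]_p) : U \in unitmx ->
  (forall i j : 'I_p, (j < i)%N -> U i j = 0) -> good U.
Proof.
move=> uU Uij; have dU : \det U = \prod_i U i i.
  rewrite -det_tr det_trig; first by apply: eq_bigr => i _; rewrite mxE.
  by apply/is_trig_mxP => i j ij; rewrite mxE Uij.
have Uii i : U i i != 0.
  by move: uU; rewrite unitmxE dU unitfE => /prodf_neq0; apply.
pose d : V := \row_i U i i; pose U1 := diag_mx (\row_i (U i i)^-1) *m U.
have U1E i j : U1 i j = (U i i)^-1 * U i j by rewrite /U1 mul_diag_mx !mxE.
have -> : U = diag_mx d *m U1.
  by apply/matrixP => i j; rewrite mul_diag_mx [RHS]mxE U1E !mxE mulrA divff// mul1r.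
apply: good_mul; first by apply: good_diag => i; rewrite mxE.
(* Nonzero off-diagonal entries of an upper triangular matrix have i < j, so the weights must
   decrease with the index. *)
apply: (@good_unitriangular (fun i => p - i)%N).
- rewrite -det_tr det_trig; first by apply: big1 => i _; rewrite mxE U1E mulVf.
  by apply/is_trig_mxP => i j ij; rewrite mxE U1E (Uij j i)// mulr0.
- by move=> i; rewrite U1E mulVf.
- move=> i j ij; rewrite U1E => U1ij; rewrite ltn_sub2l//.
  rewrite ltn_neqAle ij leqNgt; apply: contra U1ij => /Uij ->.
  by rewrite mulr0.
Qed.

Lemma leb_mulmxr_le (A : 'M[R]_p) (B : set V) : A \in unitmx -> measurable B ->
  (leb ((fun x : V => (x *m A)%R) @` B) <= (`|\det A|)%:E * leb B)%E.
Proof.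
move=> uA; suff : good A by move=> [_]; exact.
have [n pn] : exists n, p = n by exists p.
(* The LUP factorization concerns matrices of size [n.+1]; in dimension 0 the map is the identity
   and the determinant is 1. *)
case: n pn => [p0|n pn].
  split=> // C mC; rewrite (_ : _ @` C = C).
    suff -> : \det A = 1 by rewrite normr1 mul1e.
    by move: (A); rewrite p0 => A'; rewrite det_mx00.
  have e (x : V) : x *m A = x by apply/rowP => i; have := ltn_ord i; rewrite {2}p0.
  apply/seteqP; split => [_ [x Cx <-]|x Cx]; first by rewrite e.
  by exists x => //; rewrite e.
move: (good_mul) (good_upper) (good_unitriangular) (good_perm) => gm gu gt gp.
have [P [L [U [-> gP gL gU]]]] : exists P L U : 'M[R]_p,
    [/\ A = P *m L *m U, good P, good L & good U].
  move: A uA good gm gu gt gp; rewrite pn => A uA g gm gu gt gp.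
  have := cormen_lup_correct A; have := cormen_lup_perm A.
  have := cormen_lup_detL A; have := cormen_lup_lower A; have := cormen_lup_upper A.
  case: cormen_lup => [[P L] U] /= Uij Lij detL /is_perm_mxP[s ->] PA.
  have AE : A = perm_mx s^-1%g *m L *m U.
    have : perm_mx s *m A = L *m U by exact: PA.
    move=> /(congr1 (mulmx (perm_mx s^-1%g))).
    by rewrite mulmxA -perm_mxM mulVg perm_mx1 mul1mx mulmxA.
  exists (perm_mx s^-1%g), L, U; split => //.
  - apply: (gt (fun i => val i)) => //.
    + by move=> i; rewrite Lij// eqxx.
    + move=> i j ij Lij0; rewrite ltnNge; apply: contra Lij0 => ij'.
      by rewrite Lij// (negbTE ij).
  - apply: gu => //; move: uA; rewrite AE unitmx_mul => /andP[_ //].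
by apply: (gm) => //; exact: (gm).
Qed.

Lemma leb_mulmxr (A : 'M[R]_p) (B : set V) : A \in unitmx -> measurable B ->
  leb ((fun x : V => (x *m A)%R) @` B) = ((`|\det A|)%:E * leb B)%E.
Proof.
move=> uA mB; apply/eqP; rewrite eq_le leb_mulmxr_le//=.
have uA' : invmx A \in unitmx by rewrite unitmx_inv.
have d0 : (0 <= (`|\det A|)%:E)%E by rewrite lee_fin.
have := leb_mulmxr_le uA' (measurable_image_mulmxr uA mB).
rewrite -image_mulmxr_comp mulmxV// (_ : [set x *m 1%:M | x in B] = B); last first.
  apply/seteqP; split => [_ [x Bx <-]|x Bx]; first by rewrite mulmx1.
  by exists x => //; rewrite mulmx1.
move=> /(lee_wpmul2l d0) /le_trans; apply.
by rewrite muleA -EFinM -normrM -det_mulmx mulmxV// det1 normr1 mul1e.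
Qed.

End linear_maps.

(** * Linearization of a C^1 map *)

Section matrix_perturbation.
Variables (R : realType) (p : nat).
Implicit Types (A B : 'M[R]_p).

(** The entrywise l1 norm: submultiplicative, and an upper bound for every column sum, hence for the
    sup-norm Lipschitz constant of the map. *)
Definition mxsum A : R := \sum_i \sum_j `|A i j|.

Lemma mxsum_ge0 A : 0 <= mxsum A.
Proof. by apply: sumr_ge0 => i _; apply: sumr_ge0. Qed.

Lemma mxsumZ (t : R) A : mxsum (t *: A) = `|t| * mxsum A.
Proof.
rewrite /mxsum mulr_sumr; apply: eq_bigr => i _; rewrite mulr_sumr.
by apply: eq_bigr => j _; rewrite mxE normrM.
Qed.

Lemma mxsumM A B : mxsum (A *m B) <= mxsum A * mxsum B.
Proof.
rewrite /mxsum mulr_suml; apply: ler_sum => i _.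
apply: (@le_trans _ _ (\sum_j \sum_k `|A i k| * `|B k j|)).
  apply: ler_sum => j _; rewrite mxE (le_trans (ler_norm_sum _ _ _))//.
  by apply: ler_sum => k _; rewrite normrM.
rewrite exchange_big/= mulr_suml; apply: ler_sum => k _.
apply: (@le_trans _ _ (`|A i k| * \sum_j `|B k j|)); first by rewrite mulr_sumr.
rewrite ler_wpM2l// [X in _ <= X](bigD1 k)//= lerDl.
by apply: sumr_ge0 => i' _; apply: sumr_ge0.
Qed.

Lemma colsum_le_mxsum A j : \sum_i `|A i j| <= mxsum A.
Proof.
by apply: ler_sum => i _; rewrite (bigD1 j)//= lerDl sumr_ge0.
Qed.

(** The convex function c |-> (1 + c)^n lies below its chord over [0,1]. *)
Lemma expr_onep_le (c : R) n : 0 <= c <= 1 -> (1 + c) ^+ n <= 1 + c * (2 ^+ n - 1).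
Proof.
move=> /andP[c0 c1]; elim: n => [|n IH]; first by rewrite !expr0 subrr mulr0 addr0.
apply: (@le_trans _ _ ((1 + c) * (1 + c * (2 ^+ n - 1)))).
  by rewrite exprS ler_wpM2l// addr_ge0.
have : 1 <= 2 ^+ n :> R by rewrite exprn_ege1// ler1n.
rewrite [2 ^+ n.+1]exprS; set k := 2 ^+ n => k1.
have : 0 <= c * (1 - c) * (k - 1) by rewrite !mulr_ge0// subr_ge0.
by nra.
Qed.

(* For singular A = L D U with D = diag(1,..,1,0,..,0), replace the zeros of D
   by a small t: the determinant is O(t) while (A' - A) A'^-1 stays bounded. *)
Lemma invertible_perturbation A (e : R) : 0 < e ->
  exists A' d, [/\ A' \in unitmx, 0 < d &
    (1 + (d + mxsum (A - A')) * mxsum (invmx A')) ^+ p * `|\det A'| <= `|\det A| + e].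
Proof.
move=> e0; have [uA|nuA] := boolP (A \in unitmx).
  pose N := mxsum (invmx A); have N0 : 0 <= N := mxsum_ge0 _.
  pose K := `|\det A| * (2 ^+ p - 1).
  have p2 : 0 <= 2 ^+ p - 1 :> R by rewrite subr_ge0 exprn_ege1// ler1n.
  have K0 : 0 <= K by rewrite mulr_ge0.
  have k1 : 0 < 1 + N by lra.
  have k2 : 0 < 1 + K by lra.
  (* The minimum with 1 keeps d N in [0,1], where the chord bound holds; the other term keeps the
     excess d N K below e. *)
  pose d := Num.min 1 (e / (1 + K)) / (1 + N).
  have d0 : 0 < d by rewrite divr_gt0// lt_min ltr01 divr_gt0.
  exists A, d; split => //.
  rewrite subrr (_ : mxsum 0 = 0) ?addr0; last first.
    by apply: big1 => i _; apply: big1 => j _; rewrite mxE normr0.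
  rewrite -/N; have dN : d * N <= Num.min 1 (e / (1 + K)).
    rewrite /d mulrAC ler_pdivrMr// ler_wpM2l//; last by lra.
    by rewrite le_min ler01 divr_ge0// ltW.
  have dN0 : 0 <= d * N by rewrite mulr_ge0// ltW.
  have dN1 : d * N <= 1 by rewrite (le_trans dN)// ge_min lexx.
  have dNe : d * N * (1 + K) <= e by rewrite -ler_pdivlMr// (le_trans dN)// ge_min lexx orbT.
  apply: (@le_trans _ _ ((1 + d * N * (2 ^+ p - 1)) * `|\det A|)).
    by rewrite ler_wpM2r// expr_onep_le// dN0.
  rewrite mulrDl mul1r lerD2l (le_trans _ dNe)// -mulrA ler_wpM2l// mulrC -/K; lra.
have rp : (\rank A < p)%N.
  by rewrite ltn_neqAle rank_leq_row andbT; apply: contra nuA; rewrite -row_free_unit.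
have dA : \det A = 0.
  by apply/eqP; move: nuA; rewrite unitmxE unitfE negbK.
rewrite dA normr0 add0r.
set L := col_ebase A; set U := row_ebase A.
have uL : L \in unitmx by exact: col_ebase_unit.
have uU : U \in unitmx by exact: row_ebase_unit.
pose D (t : R) : 'rV[R]_p := \row_i (if (i < \rank A)%N then 1 else t).
pose A' t := L *m diag_mx (D t) *m U.
pose Q : 'M[R]_p := diag_mx (\row_i (if (i < \rank A)%N then 0 else 1)).
have AE : A = L *m pid_mx (\rank A) *m U by rewrite mulmx_ebase.
have A'E t : A' t = A + t *: (L *m Q *m U).
  rewrite /A' [X in _ = X + _]AE scalemxAl scalemxAr -mulmxDl -mulmxDr; congr (_ *m _ *m _).
  apply/matrixP => i j; rewrite !mxE.
  have [->|ij] := eqVneq i j; last first.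
    have ijn : (i == j :> nat) = false by exact/negbTE.
    by rewrite /= ijn !mulr0n mulr0 addr0.
  by rewrite eqxx !mulr1n/=; case: ifP => _; rewrite ?mulr0 ?addr0 ?mulr1 ?add0r.
have invA' t : 0 < t -> A' t \in unitmx /\
    invmx (A' t) = invmx U *m diag_mx (D t^-1) *m invmx L.
  move=> t0; have DD : diag_mx (D t) *m diag_mx (D t^-1) = 1%:M.
    rewrite mulmx_diag -diag_const_mx; congr diag_mx; apply/rowP => i; rewrite !mxE.
    by case: ifP => _; rewrite ?mulr1// divff// gt_eqF.
  have E : A' t *m (invmx U *m diag_mx (D t^-1) *m invmx L) = 1%:M.
    by rewrite /A' !mulmxA mulmxK// -(mulmxA L) DD mulmx1 mulmxV.
  have [u _] := mulmx1_unit E; split => //.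
  by rewrite -[RHS]mul1mx -(mulVmx u) -mulmxA E mulmx1.
pose C1 := mxsum (L *m Q *m U); have C10 : 0 <= C1 := mxsum_ge0 _.
(* For t <= 1 each of the p^2 entries of [diag_mx (D t^-1)] is at most 1/t, so C2 / t bounds the
   inverse of [A' t]. *)
pose C2 := mxsum (invmx U) * (p%:R * p%:R) * mxsum (invmx L).
have C20 : 0 <= C2 by rewrite !mulr_ge0 ?mxsum_ge0.
have invle t : 0 < t -> t <= 1 -> mxsum (invmx (A' t)) <= C2 / t.
  move=> t0 t1; have [_ ->] := invA' t t0.
  rewrite (le_trans (mxsumM _ _))// /C2 mulrAC ler_wpM2r ?mxsum_ge0//.
  rewrite (le_trans (mxsumM _ _))// -mulrA ler_wpM2l ?mxsum_ge0//.
  have ti : 1 <= t^-1 by rewrite invf_ge1.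
  apply: (@le_trans _ _ (\sum_(i < p) \sum_(j < p) t^-1)).
    apply: ler_sum => i _; apply: ler_sum => j _; rewrite !mxE.
    case: eqVneq => _; last by rewrite mulr0n normr0 invr_ge0 ltW.
    by rewrite mulr1n; case: ifP => _; rewrite ?normr1// ger0_norm// invr_ge0 ltW.
  by rewrite !sumr_const !card_ord -mulrnA -[X in X <= _]mulr_natl natrM.
(* With d = t the factor t (1 + C1) cancels the 1/t in the bound on the inverse, so c does not
   depend on t. *)
pose c := (1 + C1) * C2; have c0 : 0 <= c by rewrite mulr_ge0// addr_ge0.
pose K := (1 + c) ^+ p * (`|\det L| * `|\det U|).
have K0 : 0 <= K by apply: mulr_ge0; [apply: exprn_ge0; lra|exact: mulr_ge0].
have k2 : 0 < 1 + K by lra.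
pose t := Num.min 1 (e / (1 + K)).
have t0 : 0 < t by rewrite lt_min ltr01 divr_gt0.
have t1 : t <= 1 by rewrite ge_min lexx.
have tK : t * (1 + K) <= e by rewrite -ler_pdivlMr// ge_min lexx orbT.
exists (A' t), t; split => //; first by case: (invA' t t0).
have -> : A - A' t = (- t) *: (L *m Q *m U).
  by rewrite A'E opprD addrA subrr add0r scaleNr.
rewrite mxsumZ normrN (gtr0_norm t0) -/C1.
have lec : (t + t * C1) * mxsum (invmx (A' t)) <= c.
  rewrite (le_trans (ler_wpM2l _ (invle t t0 t1)))//; first by nra.
  rewrite -[X in X + _]mulr1 -mulrDr /c.
  by rewrite [t * _]mulrC mulrACA divff ?gt_eqF// mulr1.
have dA' : `|\det (A' t)| <= t * (`|\det L| * `|\det U|).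
  rewrite /A' !det_mulmx !normrM mulrAC mulrC ler_wpM2r ?mulr_ge0//.
  (* The diagonal entry at index [\rank A], the first one past the rank, equals t; the remaining
     ones are at most 1. *)
  rewrite det_diag normr_prod (bigD1 (Ordinal rp))//= mxE /= ltnn (gtr0_norm t0).
  rewrite -[X in _ <= X]mulr1 ler_wpM2l ?(ltW t0)//.
  apply: prodr_ile1 => i _; rewrite normr_ge0 mxE.
  by case: ifP => _; rewrite ?normr1//= gtr0_norm.
apply: (@le_trans _ _ ((1 + c) ^+ p * (t * (`|\det L| * `|\det U|)))).
  apply: ler_pM => //; first by rewrite exprn_ge0// addr_ge0// mulr_ge0 ?mxsum_ge0//; nra.
  rewrite lerXn2r ?nnegrE ?lerD2l// ?addr_ge0// mulr_ge0 ?mxsum_ge0//; nra.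
by rewrite mulrCA -/K (le_trans _ tK)// ler_wpM2l ?(ltW t0)//; lra.
Qed.

End matrix_perturbation.

Lemma cvg_det (K : numFieldType) (S : Type) (F : set_system S) n
    (M : S -> 'M[K]_n) (L : 'M[K]_n) : Filter F ->
  (forall i j, M u i j @[u --> F] --> L i j) -> \det (M u) @[u --> F] --> \det L.
Proof.
move=> FF cM; rewrite /determinant.
have cprod (s : {perm 'I_n}) (r : seq 'I_n) :
    \prod_(i <- r) M u i (s i) @[u --> F] --> \prod_(i <- r) L i (s i).
  elim: r => [|a r IH].
    by rewrite big_nil; under eq_fun do rewrite big_nil; exact: cvg_cst.
  by rewrite big_cons; under eq_fun do rewrite big_cons; apply: cvgM.
elim: (index_enum _) => [|s r IH].
  by rewrite big_nil; under eq_fun do rewrite big_nil; exact: cvg_cst.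
rewrite big_cons; under eq_fun do rewrite big_cons.
by apply: cvgD => //; apply: cvgM; [exact: cvg_cst|exact: cprod].
Qed.

Lemma mxBE (W : zmodType) m n (A B : 'M[W]_(m, n)) i j : (A - B) i j = A i j - B i j.
Proof. by rewrite !mxE. Qed.

Section local_linearization.
Variables (R : realType) (p : nat).
Local Notation V := 'rV[R]_p.
Variable T : V -> V.
Hypothesis dT : forall u, differentiable T u.
Hypothesis cT : forall j, continuous (fun u => 'D_(delta_mx ord0 j) T u).

Lemma jacobian_coord u (j i : 'I_p) :
  jacobian T u j i = ('D_(delta_mx ord0 j) T u) ord0 i.
Proof. by rewrite deriveEjacobian// -rowE [RHS]mxE. Qed.

Lemma continuous_jacobian_coord j i : continuous (fun u => jacobian T u j i).
Proof.
move=> u; under eq_fun do rewrite jacobian_coord.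
apply: (@continuous_comp _ _ _ (fun u => 'D_(delta_mx ord0 j) T u) (fun M : V => M ord0 i)).
  exact: cT.
exact: coord_continuous.
Qed.

Lemma is_derive_line (y v : V) (i : 'I_p) (t : R) :
  is_derive t 1 (fun t : R => T (y + t *: v) ord0 i)
    ((v *m jacobian T (y + t *: v)) ord0 i).
Proof.
have dv : derivable T (y + t *: v) v by exact: diff_derivable.
have /derivable_mxP/(_ ord0 i) di := dv.
have E : (fun h : R => h^-1 *: (((fun t : R => T (y + t *: v) ord0 i) \o shift t) (h *: 1)
    - T (y + t *: v) ord0 i)) =
   (fun h : R => h^-1 *: (((fun x => T x ord0 i) \o shift (y + t *: v)) (h *: v)
    - T (y + t *: v) ord0 i)).
  apply/funext => h /=; congr (_ *: (T _ _ _ - _)).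
  by rewrite [h *: 1]mulr1 scalerDl addrCA.
split; first by rewrite /derivable E.
by rewrite /derive E -deriveEjacobian// derive_mx// mxE.
Qed.

(** The intermediate point depends on the coordinate i, which is harmless as all later bounds are
    coordinatewise. *)
Lemma mean_value_coord (x y : V) (i : 'I_p) : exists2 t : R, 0 <= t <= 1 &
  T x ord0 i - T y ord0 i = ((x - y) *m jacobian T (y + t *: (x - y))) ord0 i.
Proof.
pose f (t : R) := T (y + t *: (x - y)) ord0 i.
have df t := is_derive_line y (x - y) i t.
have cf : {within `[0, 1], continuous f}.
  by apply: derivable_within_continuous => t _; case: (df t).
have [t t01 E] := MVT_segment ler01 (fun t _ => df t) cf.
exists t; first by move: t01; rewrite in_itv.
by move: E; rewrite /f scale1r scale0r addr0 subr0 mulr1 (addrC y) subrK.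
Qed.

Lemma cvg_det_jacobian (x0 : V) :
  \det (jacobian T u) @[u --> x0] --> \det (jacobian T x0).
Proof.
apply: (@cvg_det _ _ _ _ _ _ (nbhs_filter x0)) => j i.
exact: continuous_jacobian_coord.
Qed.

Lemma near_jacobian (x0 : V) (e : R) : 0 < e -> exists2 r, 0 < r &
  forall x : V, (forall j, `|x ord0 j - x0 ord0 j| < r) ->
    (forall j i, `|jacobian T x j i - jacobian T x0 j i| <= e) /\
    `| `|\det (jacobian T x)| - `|\det (jacobian T x0)| | <= e.
Proof.
move=> e0.
have cdet : `|\det (jacobian T u)| @[u --> x0] --> `|\det (jacobian T x0)|.
  exact: (cvg_norm (@cvg_det_jacobian x0)).
have : \forall x \near x0, (forall j i, `|jacobian T x j i - jacobian T x0 j i| <= e) /\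
    `| `|\det (jacobian T x)| - `|\det (jacobian T x0)| | <= e.
  near=> x; split; last first.
    by rewrite distrC; near: x; move/cvgrPdist_le: cdet; exact.
  near: x; apply: filter_forall => j; apply: filter_forall => i.
  near=> x; rewrite distrC; near: x.
  by have /cvgrPdist_le := @continuous_jacobian_coord j i x0; exact.
move=> /nbhs_ballP[r r0 rP]; exists r => // x xr; apply: rP; split => //= a j.
by rewrite ord1 /ball/= distrC.
Unshelve. all: by end_near. Qed.

Lemma cell_near n (x y : V) : cell n x = cell n y ->
  forall j, `|x ord0 j - y ord0 j| < 2 ^- n.
Proof.
move=> xy j.
have /cell_eqP/(_ j)/andP[x1 x2] := erefl (cell n x).
have /cell_eqP/(_ j)/andP[y1 y2] := esym xy.
have n0 : 0 < 2 ^+ n :> R by rewrite exprn_gt0.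
rewrite -[X in _ < X]mul1r ltr_pdivlMr// -[X in _ * X](gtr0_norm n0) -normrM mulrBl.
by rewrite !(mulrC _ (2 ^+ n)) ltr_norml; move: x1 x2 y1 y2; rewrite intrD1; lra.
Qed.

Lemma local_linearization (x0 : V) (e : R) : 0 < e -> exists n,
  (forall x, cell n x = cell n x0 ->
     `| `|\det (jacobian T x)| - `|\det (jacobian T x0)| | <= e) /\
  (forall x y, cell n x = cell n x0 -> cell n y = cell n x0 -> forall r,
     (forall j, `|x ord0 j - y ord0 j| <= r) -> forall i,
     `|(T x - T y - (x - y) *m jacobian T x0) ord0 i| <= e * r).
Proof.
move=> e0; have k0 : 0 < 1 + p%:R :> R by rewrite ltr_wpDr.
(* A column sum has p entries, each at most e / (1 + p); the added 1 covers dimension 0. *)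
have [r1 r10 H1] := near_jacobian x0 (divr_gt0 e0 k0).
have [r2 r20 H2] := near_jacobian x0 e0.
have /dyadic_approx[n] : 0 < Num.min r1 r2 by rewrite lt_min r10.
rewrite lt_min => /andP[nr1 nr2].
exists n; split => [x xn|x y xn yn r xyr i].
  by have [] := H2 x; first by move=> j; rewrite (lt_trans (cell_near xn _)).
rewrite 2!mxBE.
have [t /andP[t0 t1] ->] := mean_value_coord x y i.
set z := y + _.
(* z is a convex combination of x and y, both within 2^-n of x0 in every coordinate. *)
have zr j : `|z ord0 j - x0 ord0 j| < r1.
  apply: le_lt_trans nr1; have := ltW (cell_near xn j); have := ltW (cell_near yn j).
  rewrite /z !mxE !ler_norml; set a := x ord0 j; set b := y ord0 j; set c := x0 ord0 j.
  set q := 2 ^- n => /andP[h1 h2] /andP[h3 h4].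
  have u0 : 0 <= 1 - t by lra.
  have k1 : 0 <= t * (q - (a - c)) by apply: mulr_ge0 => //; lra.
  have k3 : 0 <= t * (q + (a - c)) by apply: mulr_ge0 => //; lra.
  have k2 : 0 <= (1 - t) * (q - (b - c)) by apply: mulr_ge0 => //; lra.
  have k4 : 0 <= (1 - t) * (q + (b - c)) by apply: mulr_ge0 => //; lra.
  by apply/andP; split; lra.
have [Hz _] := H1 z zr.
rewrite (_ : _ - _ = ((x - y) *m (jacobian T z - jacobian T x0)) ord0 i); last first.
  by rewrite mulmxBr mxBE.
have r0 : 0 <= r by apply: le_trans (xyr i).
move: (jacobian T z) (jacobian T x0) Hz => J1 J0 Hz.
have := @le_norm_mulmx_coord _ _ (J1 - J0) (x - y) r.
move=> /(_ _ i) /le_trans; apply; first by move=> j; rewrite mxBE.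
rewrite ler_wpM2r//; apply: (@le_trans _ _ (\sum_(j < p) e / (1 + p%:R))).
  by apply: ler_sum => j _; rewrite mxBE.
rewrite sumr_const card_ord -[X in X <= _]mulr_natr mulrAC ler_pdivrMr// ler_wpM2l ?lerDr//.
exact: ltW.
Qed.

End local_linearization.

(** * Measurability tools *)

Section caratheodory.
Variables (R : realType) (p : nat).
Local Notation V := 'rV[R]_p.

Definition cell_corner n (k : 'rV[int]_p) : V := \row_i ((k ord0 i)%:~R / 2 ^+ n).

Lemma cvg_cell_corner (x : V) : cell_corner n (cell n x) @[n --> \oo] --> x.
Proof.
move=> A /nbhs_ballP[e e0 eA].
have [m me] := dyadic_approx e0.
exists m => // n /= mn; apply: eA; split => // a i; rewrite ord1 /ball/= !mxE.
apply: le_lt_trans me; apply: (@le_trans _ _ (2 ^- n)); last first.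
  by rewrite lef_pV2 ?posrE ?exprn_gt0// ler_weXn2l// ler1n.
have n0 : 0 < 2 ^+ n :> R by rewrite exprn_gt0.
have /andP[f1 f2] := floor_itv (2 ^+ n * x ord0 i).
rewrite -[X in _ <= X]mul1r ler_pdivlMr// -[X in _ * X](gtr0_norm n0) -normrM mulrBl.
rewrite divfK ?gt_eqF// mulrC ler_norml; move: f1 f2; rewrite intrD1; set y := _ * _.
by set z := _%:~R; lra.
Qed.

(* Caratheodory functions are limits of F s (corner of the level-n cell of b),
   which are measurable since they take countably many values in b. *)
Lemma measurable_caratheodory d (S : measurableType d) (F : S -> V -> R) :
  (forall b, measurable_fun setT (fun s => F s b)) -> (forall s, continuous (F s)) ->
  measurable_fun setT (fun x : S * V => F x.1 x.2).
Proof.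
move=> mF cF.
apply: (@measurable_fun_cvg _ _ _ _ (fun n (x : S * V) => F x.1 (cell_corner n (cell n x.2)))).
  move=> n _ Y mY; rewrite setTI.
  rewrite (_ : _ @^-1` _ = \bigcup_k ([set x | F x.1 (cell_corner n k) \in Y] `&` [set x | cell n x.2 = k])).
    apply: countable_bigcupT_measurable; first exact: countableP.
    move=> k; apply: measurableI.
      rewrite (_ : mkset _ = (fun x : S * V => F x.1 (cell_corner n k)) @^-1` Y).
        rewrite -[X in measurable X]setTI.
        exact: (measurableT_comp (mF (cell_corner n k)) measurable_fst).
      by apply/seteqP; split=> x /=; rewrite inE.
    rewrite (_ : mkset _ = snd @^-1` [set y | cell n y = k])//.
    rewrite -[X in measurable X]setTI; apply: measurable_snd => //.
    exact: (measurable_cell n [set k]).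
  apply/seteqP; split=> [x /= Yx|x [k _] /= [H xk]]; last by move: H; rewrite inE xk.
  by exists (cell n x.2) => //=; split => //; rewrite inE.
move=> x _; apply: (@cvg_comp _ _ _ _ (F x.1) _ (nbhs x.2)); last exact: cF.
exact: cvg_cell_corner.
Qed.

(** The sigma-algebra on V is generated by coordinates, not by open sets, so this is deduced from
    the dyadic approximation, composed with the diagonal map. *)
Lemma continuous_measurable_rV (f : V -> R) : continuous f -> measurable_fun setT f.
Proof.
move=> cf; have H := @measurable_caratheodory _ _ (fun _ : V => f) (fun b => measurable_cst _) (fun=> cf).
have mid : measurable_fun setT (fun x : V => (x, x)) by apply: measurable_fun_pair.
exact: (measurableT_comp H mid).
Qed.

End caratheodory.

Section with_density.
Local Open Scope ereal_scope.
Context d (T : measurableType d) (R : realType) (mu : {measure set T -> \bar R}).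

(** The two proofs about [J] are arguments so that the measure structure can be attached to this
    term. *)
Definition with_density (J : T -> R) of (forall x, 0 <= J x)%R & measurable_fun setT J :
  set T -> \bar R := fun A => \int[mu]_(x in A) (J x)%:E.

Variables (J : T -> R) (J0 : (forall x, 0 <= J x)%R) (mJ : measurable_fun setT J).
Local Notation nu := (with_density J0 mJ).

Let nu0 : nu set0 = 0. Proof. exact: integral_set0. Qed.

Let nu_ge0 A : 0 <= nu A.
Proof. by apply: integral_ge0 => x _; rewrite lee_fin. Qed.

Let nu_sigma_additive : semi_sigma_additive nu.
Proof.
move=> F mF tF mUF; rewrite /with_density ge0_integral_bigcup//.
- apply: is_cvg_ereal_nneg_natsum => n _; exact: nu_ge0.
- by apply/measurable_EFinP; exact: measurable_funTS.
- by move=> x _; rewrite lee_fin.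
Qed.

HB.instance Definition _ := isMeasure.Build _ _ _ nu nu0 nu_ge0 nu_sigma_additive.

End with_density.

(** * Images under nearly linear maps *)

Section image_of_nearly_linear.
Variables (R : realType) (p : nat).
Local Notation V := 'rV[R]_p.
Variable leb : {measure set V -> \bar R}.
Hypothesis Hleb : is_lebesgue_rV leb.
Variables (T Th : V -> V) (B : set V) (A : 'M[R]_p) (d : R).
Hypotheses (mT : measurable_fun setT T) (mTh : measurable_fun setT Th).
Hypotheses (mB : measurable B) (ThT : forall x, B x -> Th (T x) = x).
Hypotheses (uA : A \in unitmx) (d0 : 0 <= d).
Hypothesis near_lin : forall x y, B x -> B y -> forall r,
  (forall j, `|x ord0 j - y ord0 j| <= r) -> forall i,
  `|(T x - T y - (x - y) *m A) ord0 i| <= d * r.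

Local Notation N := (mxsum (invmx A)).

Let inv_bound (a : V) (r : R) : (forall j, `|(a *m A) ord0 j| <= r) ->
  forall j, `|a ord0 j| <= N * r.
Proof.
move=> ar j; have := le_norm_mulmx_coord (invmx A) ar j.
rewrite mulmxK// => /le_trans; apply; rewrite ler_wpM2r//; last exact: colsum_le_mxsum.
exact: le_trans (ar j).
Qed.

(** After composition with A^-1 the map differs from the identity by an error of Lipschitz constant
    d N, hence is (1 + d N)-Lipschitz on the linear image of B. *)
Lemma leb_image_near_linear_le :
  (leb (T @` B) <= ((1 + d * N) ^+ p * `|\det A|)%:E * leb B)%E.
Proof.
pose X := (fun x : V => x *m A) @` B.
have mX : measurable X by exact: measurable_image_mulmxr.
have -> : T @` B = (fun a => T (a *m invmx A)) @` X.
  apply/seteqP; split => [_ [x Bx <-]|_ [_ [x Bx <-] <-]].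
    by exists (x *m A); [exists x|rewrite mulmxK].
  by exists x => //; rewrite mulmxK.
rewrite EFinM -muleA -(leb_mulmxr Hleb uA mB) -/X.
rewrite (_ : (1 + d * N) ^+ p = \prod_(i < p) (1 + d * N)); last by rewrite prodr_const card_ord.
have N0 : 0 <= N := mxsum_ge0 _.
apply: (leb_image_le Hleb (Th := fun w => Th w *m A)).
- exact: (measurableT_comp mT (measurable_mulmxr _)).
- exact: (measurableT_comp (measurable_mulmxr _) mTh).
- exact: mX.
- by move=> _ [x Bx <-]; rewrite mulmxK// ThT.
- by move=> i; rewrite addr_ge0// mulr_ge0.
- move=> _ _ [x Bx <-] [y By <-] r xyr i; rewrite !mulmxK//.
  have xyr' j : `|((x - y) *m A) ord0 j| <= r by rewrite mulmxBl mxBE.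
  have h j : `|x ord0 j - y ord0 j| <= N * r by rewrite -mxBE; exact: inv_bound.
  have := near_lin Bx By h i; rewrite 2!mxBE.
  have := xyr' i; move: (((x - y) *m A) ord0 i) => c.
  move: (T x ord0 i - T y ord0 i) => b bN ar.
  rewrite -(subrK c b) (le_trans (ler_normD _ _))//.
  by rewrite mulrDl mul1r addrC lerD// -mulrA.
Qed.

(** The Lipschitz bound for the reverse map [w |-> Th w *m A], whose constant is 1 / (1 - d N). *)
Lemma leb_image_near_linear_ge : d * N < 1 ->
  (((1 - d * N) ^+ p * `|\det A|)%:E * leb B <= leb (T @` B))%E.
Proof.
move=> dN; have N0 : 0 <= N := mxsum_ge0 _.
have k0 : 0 < 1 - d * N by rewrite subr_gt0.
have mTB : measurable (T @` B).
  by rewrite -[B]setIid; exact: (measurable_image mT mTh mB ThT mB).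
rewrite EFinM -muleA -(leb_mulmxr Hleb uA mB).
have -> : (fun x : V => x *m A) @` B = (fun w => Th w *m A) @` (T @` B).
  apply/seteqP; split => [_ [x Bx <-]|_ [_ [x Bx <-] <-]].
    by exists (T x); [exists x|rewrite ThT].
  by exists x => //; rewrite ThT.
have : (leb ((fun w => (Th w *m A)%R) @` (T @` B)) <=
    (\prod_(i < p) (1 - d * N)^-1)%:E * leb (T @` B))%E.
  apply: (leb_image_le Hleb (Th := fun a => T (a *m invmx A))) => //.
  - exact: (measurableT_comp (measurable_mulmxr _) mTh).
  - exact: (measurableT_comp mT (measurable_mulmxr _)).
  - by move=> _ [x Bx <-]; rewrite mulmxK// ThT.
  - by move=> i; rewrite invr_ge0 ltW.
  - move=> _ _ [x Bx <-] [y By <-] r xyr i; rewrite !ThT//.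
    (* The sup norm of (x - y) A satisfies m <= r + d N m; as d N < 1 the last term is absorbed on
       the left. *)
    pose m := \big[Num.max/0]_j `|((x - y) *m A) ord0 j|.
    have mP j : `|((x - y) *m A) ord0 j| <= m by exact: le_bigmax.
    have h j : `|x ord0 j - y ord0 j| <= N * m by rewrite -mxBE; exact: inv_bound.
    have r0 : 0 <= r by exact: le_trans (xyr i).
    have m0 : 0 <= m by exact: le_trans (mP i).
    have : m <= r + d * (N * m).
      apply: bigmax_le => [|j _]; first by rewrite addr_ge0// !mulr_ge0.
      have := near_lin Bx By h j; rewrite 2!mxBE.
      have := xyr j; move: (((x - y) *m A) ord0 j) => c.
      move: (T x ord0 j - T y ord0 j) => b br bc.
      by rewrite -(subrK b c) (le_trans (ler_normD _ _))// addrC lerD// distrC.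
    move=> mr; rewrite -mxBE -mulmxBl (le_trans (mP i))// mulrC ler_pdivlMr//.
    by move: mr; rewrite mulrA; lra.
rewrite prodr_const card_ord => /(lee_wpmul2l (_ : 0 <= ((1 - d * N) ^+ p)%:E)%E) H.
apply: le_trans (H _) _; first by rewrite lee_fin exprn_ge0// ltW.
by rewrite muleA -EFinM -exprMn divff ?gt_eqF// expr1n mul1e.
Qed.

End image_of_nearly_linear.

(** * Change of variables for C^1 maps *)

Section change_of_variables.
Variables (R : realType) (p : nat).
Local Notation V := 'rV[R]_p.
Variable leb : {measure set V -> \bar R}.
Hypothesis Hleb : is_lebesgue_rV leb.
Variables (T Th : V -> V) (X : set V).
Hypothesis dT : forall u, differentiable T u.
Hypothesis cT : forall j, continuous (fun u => 'D_(delta_mx ord0 j) T u).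
Hypotheses (mTh : measurable_fun setT Th) (mX : measurable X).
Hypothesis ThT : forall x, X x -> Th (T x) = x.

Local Notation J := (fun u => `|\det (jacobian T u)|).

Lemma measurable_differentiable_rV : measurable_fun setT T.
Proof.
apply: measurable_fun_rVP => i; apply: continuous_measurable_rV => u.
apply: (@continuous_comp _ _ _ T (fun M : V => M ord0 i)).
  exact: differentiable_continuous.
exact: coord_continuous.
Qed.
Let mT := measurable_differentiable_rV.

Lemma measurable_abs_det_jacobian : measurable_fun setT J.
Proof.
apply: continuous_measurable_rV => u.
have c : `|\det (jacobian T x)| @[x --> (u : V)] --> `|\det (jacobian T u)|.
  exact: (cvg_norm (@cvg_det_jacobian _ _ _ dT cT u)).
exact: c.
Qed.
Let mJ := measurable_abs_det_jacobian.
Let J0 u : 0 <= J u. Proof. exact: normr_ge0. Qed.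

Local Open Scope ereal_scope.

Let muJ : {measure set V -> \bar R} := with_density leb J0 mJ.

Lemma density_near_constant (B : set V) (c e : R) : measurable B -> (0 <= c)%R -> (0 <= e)%R ->
  (forall x, B x -> `|J x - c| <= e)%R ->
  c%:E * leb B <= muJ B + e%:E * leb B /\ muJ B <= (c + e)%:E * leb B.
Proof.
move=> mB c0 e0 H; rewrite /muJ /= /with_density.
have mJB : measurable_fun B (EFin \o J) by apply/measurable_EFinP; exact: measurable_funTS.
split.
  rewrite -!integral_cst//.
  have -> : \int[leb]_(x in B) (J x)%:E + \int[leb]_(x in B) cst e%:E x =
      \int[leb]_(x in B) ((J x)%:E + e%:E).
    by rewrite ge0_integralD// => x _; rewrite lee_fin.
  apply: ge0_le_integral => //.
  - by apply: emeasurable_funD.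
  - by move=> x /H; rewrite -EFinD lee_fin ler_norml; lra.
rewrite -integral_cst//; apply: ge0_le_integral => //.
by move=> x /H; rewrite lee_fin ler_norml; lra.
Qed.

Lemma image_density_local (x0 : V) (e : R) : (0 < e)%R -> exists n,
  forall B, measurable B -> B `<=` X -> B `<=` [set y | cell n y = cell n x0] ->
  leb (T @` B) <= muJ B + e%:E * leb B /\ muJ B <= leb (T @` B) + e%:E * leb B.
Proof.
move=> e0; pose e' := (e / 2)%R; have e'0 : (0 < e')%R by rewrite divr_gt0.
set A := jacobian T x0.
(* The upper bound on the image is taken with A', since A may be singular; the lower bound will use
   A itself. *)
have [A' [d1 [uA' d10 HA']]] := invertible_perturbation A e'0.
pose N := mxsum (invmx A); have N0 : (0 <= N)%R := mxsum_ge0 _.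
pose m := (1 + p%:R * `|\det A|)%R.
have m0 : (0 < m)%R by rewrite ltr_pwDl// mulr_ge0.
have N1 : (0 < 1 + N)%R by rewrite ltr_pwDl.
(* The term 1/2 keeps 1 - d2 N positive, and e'/m makes the Bernoulli loss p d2 N |det A| at most
   e'. *)
pose d2 := (Num.min (2^-1) (e' / m) / (1 + N))%R.
have d20 : (0 < d2)%R by rewrite divr_gt0// lt_min invr_gt0 ltr0n divr_gt0.
have d2N : (d2 * N <= Num.min (2^-1) (e' / m))%R.
  rewrite /d2 mulrAC ler_pdivrMr// ler_wpM2l ?lerDr//.
  by rewrite le_min invr_ge0 ler0n ltW// divr_gt0.
have [n [Hdet Hlin]] : exists n,
  (forall x, cell n x = cell n x0 -> `| J x - `|\det A| | <= e')%R /\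
  (forall x y, cell n x = cell n x0 -> cell n y = cell n x0 -> forall r,
     (forall j, `|x ord0 j - y ord0 j| <= r)%R -> forall i,
     (`|(T x - T y - (x - y) *m A) ord0 i| <= Num.min d1 d2 * r)%R).
  have [n1 [Hdet _]] := local_linearization dT cT x0 e'0.
  have dm : (0 < Num.min d1 d2)%R by rewrite lt_min d10.
  have [n2 [_ Hlin]] := local_linearization dT cT x0 dm.
  exists (maxn n1 n2); split.
    by move=> x /(cell_coarsen (leq_maxl n1 n2)); exact: Hdet.
  move=> x y /(cell_coarsen (leq_maxr n1 n2)) xn /(cell_coarsen (leq_maxr n1 n2)) yn.
  exact: Hlin.
exists n => B mB BX Bn.
have ThTB x : B x -> Th (T x) = x by move/BX/ThT.
have [Jge Jle] := @density_near_constant B `|\det A| e' mB (normr_ge0 _) (ltW e'0)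
  (fun x Bx => Hdet x (Bn x Bx)).
have coord_r0 (x y : V) r : (forall j, `|x ord0 j - y ord0 j| <= r)%R ->
    forall i : 'I_p, (0 <= r)%R by move=> h i; exact: le_trans (h i).
have ee : e%:E * leb B = e'%:E * leb B + e'%:E * leb B.
  by rewrite -ge0_muleDl ?lee_fin ?(ltW e'0)// -EFinD -splitr.
split.
  apply: (@le_trans _ _ ((`|\det A| + e')%:E * leb B)); last first.
    rewrite EFinD ge0_muleDl ?lee_fin ?(ltW e'0)// ee addeA leeD2r//.
  have D0 : (0 <= d1 + mxsum (A - A'))%R by rewrite addr_ge0 ?mxsum_ge0// ltW.
  apply: le_trans (leb_image_near_linear_le Hleb mT mTh mB ThTB uA' D0 _) _.
    move=> x y Bx By r xyr i; have r0 := coord_r0 _ _ _ xyr i.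
    (* Replacing A by A' adds [mxsum (A - A')] to the linearization error d1. *)
    rewrite (_ : _ - _ = (T x - T y - (x - y) *m A) + (x - y) *m (A - A'))%R; last first.
      by rewrite mulmxBr addrA subrK.
    rewrite mxE (le_trans (ler_normD _ _))// mulrDl lerD//.
      apply: le_trans (Hlin _ _ (Bn _ Bx) (Bn _ By) _ xyr i) _.
      by rewrite ler_wpM2r// ge_min lexx.
    have := @le_norm_mulmx_coord _ _ (A - A') (x - y)%R r.
    move=> /(_ _ i) /le_trans; apply; first by move=> j; rewrite mxBE.
    by rewrite ler_wpM2r// colsum_le_mxsum.
  by rewrite lee_wpmul2r// lee_fin.
apply: le_trans Jle _; rewrite EFinD ge0_muleDl ?lee_fin ?(ltW e'0)// ee addeA leeD2r//.
(* For singular A the term to be bounded is zero. *)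
have [uA|nuA] := boolP (A \in unitmx); last first.
  have -> : \det A = 0%R by apply/eqP; move: nuA; rewrite unitmxE unitfE negbK.
  by rewrite normr0 mul0e adde_ge0// mule_ge0// lee_fin ltW.
have dN1 : (d2 * N <= 2^-1)%R by rewrite (le_trans d2N)// ge_min lexx.
have dNm : (d2 * N * m <= e')%R by rewrite -ler_pdivlMr// (le_trans d2N)// ge_min lexx orbT.
have dN0 : (0 <= d2 * N)%R by rewrite mulr_ge0// ltW.
have H : ((1 - d2 * N) ^+ p * `|\det A|)%:E * leb B <= leb (T @` B).
  apply: (leb_image_near_linear_ge Hleb mT mTh mB ThTB uA (ltW d20)).
    move=> x y Bx By r xyr i; have r0 := coord_r0 _ _ _ xyr i.
    apply: le_trans (Hlin _ _ (Bn _ Bx) (Bn _ By) _ xyr i) _.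
    by rewrite ler_wpM2r// ge_min lexx orbT.
  by rewrite (le_lt_trans dN1)// invf_lt1// ltr1n.
apply: le_trans (leeD2r _ H); rewrite -ge0_muleDl; last 2 first.
- rewrite lee_fin mulr_ge0// exprn_ge0// subr_ge0 (le_trans dN1)// invf_le1// ler1n//.
- by rewrite lee_fin ltW.
rewrite lee_wpmul2r// -EFinD lee_fin.
have b : (1 - p%:R * (d2 * N) <= (1 - d2 * N) ^+ p)%R.
  apply: expr_onem_ge; rewrite dN0 (le_trans dN1)// invf_le1// ler1n//.
apply: (@le_trans _ _ ((1 - p%:R * (d2 * N)) * `|\det A| + e')%R); last first.
  by rewrite lerD2r ler_wpM2r.
move: dNm dN0; rewrite /m; move: (`|\det A|)%R (d2 * N)%R => a q; nra.
Qed.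

Theorem change_of_variables_set (B : set V) : measurable B -> B `<=` X ->
  leb (T @` B) = \int[leb]_(x in B) (J x)%:E.
Proof.
have [nu nuE0] := image_measure_exists mT mTh mX ThT leb.
have nuE C : measurable C -> C `<=` X -> nu C = leb (T @` C).
  by move=> mC CX; rewrite nuE0// setIidl.
have approx (e : {nonneg R}) : (0 < e%:num)%R -> forall C, measurable C -> C `<=` X ->
    nu C <= muJ C + (e%:num)%:E * leb C /\ muJ C <= nu C + (e%:num)%:E * leb C.
  move=> e0 C mC CX.
  (* The error term is itself a measure, so the estimate is a comparison of measures and can be
     globalized from cells. *)
  pose le : {measure set V -> \bar R} := mscale e leb.
  split.
    suff : nu C <= measure_add muJ le C by rewrite measure_addE.
    apply: (@le_measure_locally _ _ _ _ X) => // x Xx.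
    have [n H] := image_density_local x e0; exists n => D mD DX Dn.
    change (nu D <= measure_add muJ le D).
    by rewrite measure_addE nuE//; have [] := H D mD DX Dn.
  suff : muJ C <= measure_add nu le C by rewrite measure_addE.
  apply: (@le_measure_locally _ _ _ _ X) => // x Xx.
  have [n H] := image_density_local x e0; exists n => D mD DX Dn.
  change (muJ D <= measure_add nu le D).
  by rewrite measure_addE nuE//; have [] := H D mD DX Dn.
(* e can be sent to 0 only where [leb] is finite, so the limit is taken inside unit cells and
   localization is used a second time. *)
have fin (C : set V) (x : V) : measurable C -> C `<=` [set y | cell 0 y = cell 0 x] -> leb C <= 1.
  move=> mC C0; apply: (@le_trans _ _ (leb [set y | cell 0 y = cell 0 x])).
    apply: le_measure; rewrite ?inE//; exact: (measurable_cell 0 [set cell 0 x]).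
  by have := leb_cell_le Hleb 0 (cell 0 x); rewrite expr0 invr1 expr1n.
have lim (a b c : \bar R) : (0 <= b) -> 0 <= c -> c <= 1 ->
    (forall e : {nonneg R}, (0 < e%:num)%R -> a <= b + (e%:num)%:E * c) -> a <= b.
  move=> b0 c0 c1 H; apply/lee_addgt0Pr => e e0.
  have := H (NngNum (ltW e0)) e0 => /le_trans; apply; rewrite leeD2l//=.
  by rewrite -[X in _ <= X]mule1 lee_wpmul2l// lee_fin ltW.
move=> mB BX; rewrite -nuE//; apply/eqP; rewrite eq_le; apply/andP; split.
  apply: (@le_measure_locally _ _ nu muJ X) => // x Xx; exists 0%N => C mC CX C0.
  have C1 := fin C x mC C0; apply: (lim _ _ (leb C)) => //.
  by move=> e e0; have [] := approx e e0 C mC CX.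
apply: (@le_measure_locally _ _ muJ nu X) => // x Xx; exists 0%N => C mC CX C0.
have C1 := fin C x mC C0; apply: (lim _ _ (leb C)) => //.
by move=> e e0; have [] := approx e e0 C mC CX.
Qed.

End change_of_variables.

(** * Transfer of integrals *)

Section integral_transfer.
Local Open Scope ereal_scope.
Context d1 d2 (S1 : measurableType d1) (S2 : measurableType d2) (R : realType).
Variables (mu1 : {measure set S1 -> \bar R}) (mu2 : {measure set S2 -> \bar R}).
Variables (Th : S1 -> S2) (E : set S1) (D : set S2) (J : S2 -> R).
Hypotheses (mTh : measurable_fun setT Th) (mE : measurable E) (mD : measurable D).
Hypotheses (J0 : forall x, (0 <= J x)%R) (mJ : measurable_fun setT J).
Hypothesis transfer : forall B, measurable B ->
  mu1 (E `&` Th @^-1` B) = \int[mu2]_(x in D `&` B) (J x)%:E.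

Import HBNNSimple.

(** [transfer] says that [Th] sends [mu1] on E to the measure of density [J] on D; this passes from
    indicators to simple functions and then to monotone limits. *)
Lemma ge0_integral_transfer (h : S2 -> R) : measurable_fun setT h -> (forall y, 0 <= h y)%R ->
  \int[mu1]_(w in E) (h (Th w))%:E = \int[mu2]_(y in D) (h y * J y)%:E.
Proof.
move=> mh h0.
have mh' : measurable_fun setT (EFin \o h) by exact/measurable_EFinP.
pose h_ := nnsfun_approx measurableT mh'.
have cvgh y : (EFin \o h_^~ y) n @[n --> \oo] --> (h y)%:E.
  by apply: (cvg_nnsfun_approx measurableT mh') => // z _; rewrite lee_fin.
have ndh y m n : (m <= n)%N -> (h_ m y <= h_ n y)%R.
  by move=> mn; exact/lefP/nd_nnsfun_approx.
have mhn n : measurable_fun setT (h_ n) by exact: measurable_funP.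
transitivity (limn (fun n => \int[mu1]_(w in E) (h_ n (Th w))%:E)).
  rewrite -monotone_convergence//.
  - by apply: eq_integral => w _; apply/esym/cvg_lim => //; exact: cvgh.
  - move=> n; apply/measurable_EFinP; apply: measurable_funTS.
    exact: (measurableT_comp (mhn n) mTh).
  - by move=> n w _; rewrite lee_fin.
  - by move=> w _ m n mn; rewrite lee_fin ndh.
transitivity (limn (fun n => \int[mu2]_(y in D) (h_ n y * J y)%:E)); last first.
  rewrite -monotone_convergence//.
  - apply: eq_integral => y _; apply/cvg_lim => //.
    rewrite EFinM; under eq_fun do rewrite EFinM.
    by apply: cvgeZr => //; exact: cvgh.
  - move=> n; apply/measurable_EFinP; apply: measurable_funTS.
    exact: measurable_funM.
  - by move=> n w _; rewrite lee_fin mulr_ge0.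
  - by move=> w _ m n mn; rewrite lee_fin ler_wpM2r// ndh.
congr (limn _); apply/funext => n; set k := h_ n.
have mk r : measurable (k @^-1` [set r]) by [].
transitivity (\sum_(r \in range k) \int[mu1]_(w in E) (r * \1_(k @^-1` [set r]) (Th w))%:E).
  under eq_integral do rewrite (fimfunE k) -fsumEFin//.
  rewrite ge0_integral_fsum//.
  - move=> r; apply/measurable_EFinP; apply: measurable_funTS; apply: measurable_funM => //.
    by apply: (measurableT_comp _ mTh); exact: measurable_indic.
  - by move=> r w _; exact: nnfun_muleindic_ge0.
transitivity (\sum_(r \in range k) \int[mu2]_(y in D) (r * \1_(k @^-1` [set r]) y * J y)%:E); last first.
  rewrite -ge0_integral_fsum//.
  - apply: eq_integral => y _; rewrite [in RHS](fimfunE k) EFinM -fsumEFin//.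
    rewrite ge0_mule_fsuml//.
    by move=> r; exact: nnfun_muleindic_ge0.
  - move=> r; apply/measurable_EFinP; apply: measurable_funTS; apply: measurable_funM => //.
    by apply: measurable_funM => //; exact: measurable_indic.
  - by move=> r y _; rewrite EFinM mule_ge0 ?lee_fin//; exact: nnfun_muleindic_ge0.
apply: eq_fsbigr => r /set_mem [y0 _ ry0].
have r0 : (0 <= r)%R by rewrite -ry0.
set A := k @^-1` [set r]; have mA : measurable A by exact: mk.
have mThA : measurable (Th @^-1` A) by rewrite -[X in measurable X]setTI; exact: mTh.
transitivity (r%:E * mu1 (E `&` Th @^-1` A)).
  under eq_integral do rewrite EFinM.
  rewrite ge0_integralZl_EFin//.
  - congr (_ * _); rewrite (eq_integral (fun w => (\1_(Th @^-1` A) w)%:E))//.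
    by rewrite integral_indic// setIC.
  apply/measurable_EFinP; apply: measurable_funTS.
  by apply: (measurableT_comp _ mTh); exact: measurable_indic.
rewrite transfer//.
under [RHS]eq_integral do rewrite -mulrA EFinM.
rewrite ge0_integralZl_EFin//; last 2 first.
- by move=> y _; rewrite lee_fin mulr_ge0.
- apply/measurable_EFinP; apply: measurable_funTS; apply: measurable_funM => //.
congr (_ * _); rewrite integral_mkcondr; apply: eq_integral => y _.
by rewrite patchE indicE; case: ifPn => yA; rewrite ?mul1r ?mul0r.
Qed.

End integral_transfer.

(** * The reconstruction map on a fiber *)

Section rV_maps.
Variables (R : realType) (p : nat).
Local Notation V := 'rV[R]_p.

Lemma cvg_rV (S : Type) (F : set_system S) (f : S -> V) (l : V) : Filter F ->
  (forall i, f u ord0 i @[u --> F] --> l ord0 i) -> f @ F --> l.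
Proof.
move=> FF H A /nbhs_ballP[e e0 eA].
have : \forall u \near F, forall i, ball (l ord0 i) e (f u ord0 i).
  by apply: filter_forall => i; have := H i; apply; exact: nbhsx_ballx.
by apply: filterS => u Hu; apply: eA; split => // a i; rewrite ord1.
Qed.

Lemma cvg_mulmxr_coord (S : Type) (F : set_system S) (f : S -> V) (l : V)
    (A : 'M[R]_p) j : Filter F ->
  (forall i, f u ord0 i @[u --> F] --> l ord0 i) ->
  (f u *m A) ord0 j @[u --> F] --> (l *m A) ord0 j.
Proof.
move=> FF H; rewrite mxE; under eq_fun do rewrite mxE.
have csum (r : seq 'I_p) : \sum_(k <- r) f u ord0 k * A k j @[u --> F] -->
    \sum_(k <- r) l ord0 k * A k j.
  elim: r => [|a r IH].
    by rewrite big_nil; under eq_fun do rewrite big_nil; exact: cvg_cst.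
  rewrite big_cons; under eq_fun do rewrite big_cons.
  by apply: cvgD => //; apply: cvgM; [exact: H|exact: cvg_cst].
exact: csum.
Qed.

Lemma continuous_mulmxr (A : 'M[R]_p) : continuous (mulmxr A : V -> V).
Proof.
move=> x; apply: (cvg_rV (nbhs_filter x)) => j /=.
apply: (@cvg_mulmxr_coord V (nbhs x) (fun u => u) x A j (nbhs_filter x)) => i.
exact: coord_continuous.
Qed.

(** For steps in (0,1] convexity bounds the difference quotient at [a] towards [b] by [L b - L a]; a
    larger derivative would violate this at some small step. *)
Lemma convex_above_tangent (L : V -> R) (G : V -> V) : convex_fun L ->
  C2_with_gradient L G -> forall a b, L a + dotp (G a) (b - a) <= L b.
Proof.
move=> cL [dL DL _ _] a b; rewrite -lerBrDl -DL leNgt; apply/negP => lt.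
have := diff_derivable (v := b - a) (dL a).
rewrite /derivable => /cvgr_gt/(_ _ lt) [e /= e0 He].
pose h := Num.min (e / 2) 1.
have h0 : 0 < h by rewrite lt_min ltr01 divr_gt0.
have h1 : h <= 1 by rewrite ge_min lexx orbT.
have he : h < e by rewrite gt_min ltr_pdivrMr// ltr_pMr// ltr1n.
have := He h; rewrite /ball/= sub0r normrN gtr0_norm// => /(_ he).
rewrite gt_eqF// => /(_ isT); apply/negP; rewrite -leNgt.
have := cL b a h; rewrite (ltW h0) h1 => /(_ isT).
have -> : h *: b + (1 - h) *: a = h *: (b - a) + a.
  by rewrite scalerBr scalerBl scale1r addrAC addrA.
move=> H; rewrite /shift/= [_ *: _]mulrC ler_pdivrMr//.
by lra.
Qed.

End rV_maps.

Section fiber.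
Variables (R : realType) (p : nat).
Local Notation V := 'rV[R]_p.
Variables (L : V -> R) (gam : V -> V) (lam : R) (E : {set 'I_p}) (bhat : V -> V).
Hypotheses (lam0 : 0 < lam) (cL : convex_fun L) (gL : C2_with_gradient L gam).
Hypothesis bhatP : forall w,
  unique_minimizer (fun b => L b + lam * norm1 b - dotp w b) (bhat w).

Definition free_coords : set V := [set u | forall i, i \notin E -> `|u ord0 i| < 1].

Local Notation zhat w := (lam^-1 *: (w - gam (bhat w))).
Local Notation psi := (psi2 gam lam E).

Definition free_estimate (w : V) : V := packBZ E (bhat w) (zhat w).

Lemma inB_free (u : V) : inB E (betaOf E u) (zOf E u) <-> free_coords u.
Proof.
split => [[_ _ H] i iE|H]; first by have := H i iE; rewrite mxE (negbTE iE).
by split => i iE; rewrite !mxE ?iE ?(negbTE iE)//; exact: H.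
Qed.

Lemma zOf_subgradient (u : V) i : free_coords u ->
  `|zOf E u ord0 i| <= 1 /\ zOf E u ord0 i * betaOf E u ord0 i = `|betaOf E u ord0 i|.
Proof.
move=> Xu; rewrite !mxE; case: ifPn => iE.
  by rewrite -normrEsg normr_sg; split => //; case: (_ != 0).
by rewrite mulr0 normr0 ltW// Xu.
Qed.

(** Sufficiency of the KKT conditions: the tangent inequality for L and the subgradient inequality
    for the l1 norm add up to minimality of [betaOf E u], and uniqueness identifies it with
    [bhat]. *)
Lemma bhat_psi2 (u : V) : free_coords u -> bhat (psi u) = betaOf E u.
Proof.
move=> Xu; symmetry; apply: (proj2 (bhatP _)) => c.
set w := psi u; set b := betaOf E u; set z := zOf E u.
have H := convex_above_tangent cL gL b c.
have wE : dotp w c - dotp w b = dotp (gam b) (c - b) + lam * \sum_i z ord0 i * (c - b) ord0 i.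
  rewrite /dotp -sumrB mulr_sumr -big_split/=; apply: eq_bigr => i _.
  have -> : w ord0 i = gam b ord0 i + lam * z ord0 i.
    by rewrite /w /psi2 mxE; congr (_ + _); rewrite mxE.
  by rewrite !mxBE; ring.
have nE : \sum_i z ord0 i * (c - b) ord0 i <= norm1 c - norm1 b.
  rewrite /norm1 -sumrB; apply: ler_sum => i _; rewrite mxBE mulrBr.
  have [z1 ->] := zOf_subgradient i Xu; rewrite lerD2r.
  by rewrite (le_trans (ler_norm _))// normrM ler_piMl.
have := ler_wpM2l (ltW lam0) nE; rewrite mulrBr.
by move: H wE; move: (dotp w c) (dotp w b) => ? ?; lra.
Qed.

Lemma free_estimate_psi2 (u : V) : free_coords u -> free_estimate (psi u) = u.
Proof.
move=> Xu; rewrite /free_estimate bhat_psi2//; apply/rowP => i; rewrite !mxE.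
have [//|iE] := boolP (i \in E).
by rewrite addrAC subrr add0r mulrA mulVf ?gt_eqF// mul1r.
Qed.

(** On the event, the constraints of B recover both vectors from the packed one, and the definition
    of [zhat] then returns w. *)
Lemma psi2_free_estimate (w : V) : inB E (bhat w) (zhat w) ->
  free_coords (free_estimate w) /\ psi (free_estimate w) = w.
Proof.
move=> [H1 H2 H3]; have bE : betaOf E (free_estimate w) = bhat w.
  apply/rowP => i; rewrite [LHS]mxE [free_estimate _ _ _]mxE.
  by have [//|iE] := boolP (i \in E); rewrite H1.
have zE : zOf E (free_estimate w) = zhat w.
  apply/rowP => i; rewrite [LHS]mxE [free_estimate _ _ _]mxE.
  by have [iE|//] := boolP (i \in E); rewrite H2.
split; first by apply/inB_free; rewrite bE zE.
by rewrite /psi2 bE zE scalerA divff ?gt_eqF// scale1r addrC subrK.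
Qed.

Lemma event_image : [set w | inB E (bhat w) (zhat w)] = psi @` free_coords.
Proof.
apply/seteqP; split => [w /psi2_free_estimate[Xw wE]|_ [u Xu <-]] /=.
  by exists (free_estimate w).
rewrite bhat_psi2// (_ : lam^-1 *: _ = zOf E u); first exact/inB_free.
by rewrite /psi2 addrAC subrr add0r scalerA mulVf ?gt_eqF// scale1r.
Qed.

End fiber.

(** * Sign patterns of the active coordinates *)

Section sign_patterns.
Variables (R : realType) (p : nat).
Local Notation V := 'rV[R]_p.
Variables (gam : V -> V) (lam : R) (E : {set 'I_p}).
Hypothesis dG : forall b, differentiable gam b.
Hypothesis cG : forall v, continuous (fun b => 'D_v gam b).

Definition activeP : 'M[R]_p := diag_mx (\row_i (i \in E)%:R).
Definition inactiveP : 'M[R]_p := diag_mx (\row_i (i \notin E)%:R).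

(** Integer valued, so that its fibers form a countable partition as [le_measure_fibers]
    requires. *)
Definition sign_pattern (u : V) : 'rV[int]_p := \row_i (if i \in E then sgz (u ord0 i) else 0).

(* Unlike psi2, this map is C^1 on the whole space, including where an active
   coordinate vanishes; it agrees with psi2 on the points of sign pattern k. *)
Definition psi_pattern (k : 'rV[int]_p) (u : V) : V :=
  gam (u *m activeP) + lam *: (\row_i (if i \in E then (k ord0 i)%:~R else 0) + u *m inactiveP).

(** The Jacobian of [psi_pattern k], the same for all k because the pattern enters only through an
    additive constant. *)
Definition jac (u : V) : 'M[R]_p := \matrix_(j, i)
  ('D_(delta_mx ord0 j *m activeP) gam (u *m activeP) +
   lam *: (delta_mx ord0 j *m inactiveP)) ord0 i.

Lemma mulmx_activeP (u : V) : u *m activeP = betaOf E u.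
Proof.
apply/rowP => i; rewrite mul_mx_diag !mxE; case: ifP => _; by rewrite ?mulr1 ?mulr0.
Qed.

Lemma psi_patternE (u : V) : psi2 gam lam E u = psi_pattern (sign_pattern u) u.
Proof.
rewrite /psi2 /psi_pattern mulmx_activeP; congr (_ + _ *: _).
apply/rowP => i; rewrite mxE [RHS]mxE mul_mx_diag !mxE.
by case: ifPn => iE; rewrite ?mulr0 ?mulr1 ?addr0 ?add0r// sgrEz.
Qed.

Lemma is_diff_psi_pattern k (u : V) : is_diff u (psi_pattern k)
  (fun v => 'd gam (u *m activeP) (v *m activeP) + lam *: (v *m inactiveP)).
Proof.
have dl (A : 'M[R]_p) : is_diff u (mulmxr A : V -> V) (mulmxr A).
  apply: DiffDef; first exact/linear_differentiable/continuous_mulmxr.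
  exact/diff_lin/continuous_mulmxr.
pose c : V := \row_i (if i \in E then (k ord0 i)%:~R else 0).
have d1 : is_diff u (gam \o mulmxr activeP) ('d gam (u *m activeP) \o mulmxr activeP).
  apply: is_diff_comp; apply: DiffDef => //; exact: dG.
have d2 : is_diff u (lam *: ((cst c : V -> V) + (mulmxr inactiveP : V -> V)))
     (lam *: ((0 : V -> V) + (mulmxr inactiveP : V -> V))).
  apply: is_diffZ; apply: is_diffD; exact: is_diff_cst.
have := is_diffD d1 d2.
rewrite (_ : _ + lam *: (0 + _) = (fun v => 'd gam (u *m activeP) (v *m activeP) + lam *: (v *m inactiveP)))//.
by apply/funext => v /=; rewrite fctE /= add0r.
Qed.

Lemma differentiable_psi_pattern k (u : V) : differentiable (psi_pattern k) u.
Proof. by case: (is_diff_psi_pattern k u). Qed.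

Lemma derive_psi_pattern k (u v : V) : 'D_v (psi_pattern k) u =
  'D_(v *m activeP) gam (u *m activeP) + lam *: (v *m inactiveP).
Proof.
rewrite (deriveE _ (dG _)) (deriveE _ (differentiable_psi_pattern k u)).
have [_ dE] := is_diff_psi_pattern k u.
exact: (congr1 (fun f : V -> V => f v) dE).
Qed.

Lemma jacobian_psi_pattern k u : jacobian (psi_pattern k) u = jac u.
Proof.
apply/matrixP => j i; rewrite jacobian_coord ?derive_psi_pattern ?mxE//.
exact: differentiable_psi_pattern.
Qed.

Lemma continuous_derive_psi_pattern k v : continuous (fun u => 'D_v (psi_pattern k) u).
Proof.
move=> u; under eq_fun do rewrite derive_psi_pattern.
have c1 := @continuous_comp _ _ _ (mulmxr activeP : V -> V)
  (fun b => 'D_(v *m activeP) gam b) u (@continuous_mulmxr _ _ activeP u)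
  (@cG (v *m activeP) (u *m activeP)).
exact: (cvgD c1 (cvg_cst _)).
Qed.

Lemma near_sign_pattern (u : V) : (forall i, i \in E -> u ord0 i != 0) ->
  \forall v \near u, sign_pattern v = sign_pattern u.
Proof.
move=> u0; have : \forall v \near u, forall i, i \in E -> sgz ((v : V) ord0 i) = sgz (u ord0 i).
  apply: (@filter_forall _ _ _ _ (nbhs_filter u)) => i; have [iE|iE] := boolP (i \in E); last exact: filterE.
  have ci : (fun v : V => v ord0 i) @ u --> u ord0 i by exact: coord_continuous.
  have [neg|pos|z] := ltrgtP (u ord0 i) 0; last by move: (u0 i iE); rewrite z eqxx.
    have /cvgr_lt/(_ _ neg) := ci; apply: filterS => v vn _.
    by rewrite !ltr0_sgz.
  have /cvgr_gt/(_ _ pos) := ci; apply: filterS => v vn _.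
  by rewrite !gtr0_sgz.
apply: filterS => v H; apply/rowP => i; rewrite !mxE.
by case: ifPn => // iE; exact: H.
Qed.

Lemma JpsiE (u : V) : (forall i, i \in E -> u ord0 i != 0) -> Jpsi gam lam E u = `|\det (jac u)|.
Proof.
(* [Jpsi] indexes outputs by rows, while [jac] acts on row vectors and indexes them by columns. *)
move=> u0; rewrite /Jpsi -det_tr; congr (`|\det _|); apply/matrixP => j i.
rewrite !mxE (@near_eq_derive _ _ _ _ (psi_pattern (sign_pattern u))).
  by rewrite derive_psi_pattern !mxE.
have := near_sign_pattern u0; apply: filterS => v vu.
by rewrite psi_patternE vu.
Qed.

Variable leb : {measure set V -> \bar R}.
Hypothesis Hleb : is_lebesgue_rV leb.
Variables (X : set V) (Th : V -> V).
Hypotheses (mpsi : measurable_fun setT (psi2 gam lam E)) (mTh : measurable_fun setT Th).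
Hypothesis mjac : measurable_fun setT (fun u => `|\det (jac u)|).
Hypotheses (mX : measurable X) (ThX : forall u, X u -> Th (psi2 gam lam E u) = u).

(** [psi2] may jump where an active coordinate changes sign, so the C^1 theorem is applied to
    [psi_pattern k] on each pattern and the pieces are added. *)
Lemma psi2_change_of_variables (B : set V) : measurable B ->
  (leb (psi2 gam lam E @` (B `&` X)) = \int[leb]_(u in B `&` X) (`|\det (jac u)|)%:E)%E.
Proof.
move=> mB.
have [nu nuE] := image_measure_exists mpsi mTh mX ThX leb.
pose muJ : {measure set V -> \bar R} := with_density leb (fun u => normr_ge0 (\det (jac u))) mjac.
have mB' : measurable (B `&` X) by exact: measurableI.
have mpat k : measurable [set u | sign_pattern u = k].
  rewrite (_ : mkset _ = \bigcap_(i in @setT 'I_p)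
      [set u : V | (if i \in E then sgz (u ord0 i) else 0) = k ord0 i]).
    apply: fin_bigcap_measurable; first exact: finite_finset.
    move=> i _; have [iE|iE] := boolP (i \in E); last first.
      have [<-|ki] := eqVneq 0 (k ord0 i); first by rewrite (_ : mkset _ = setT)//; apply/seteqP; split.
      rewrite (_ : mkset _ = set0)//; apply/seteqP; split => // x /= e.
      by move: ki; rewrite e eqxx.
    rewrite (_ : mkset _ = (fun v : V => v ord0 i) @^-1` [set x | sgz x = k ord0 i])//.
    rewrite -[X in measurable X]setTI; apply: measurable_rV_coord => //.
    have [k1|k1] := eqVneq (k ord0 i) 1.
      rewrite k1 (_ : mkset _ = `]0, +oo[%classic)//.
      by apply/seteqP; split => x /=; rewrite in_itv/= andbT -sgz_cp0 => /eqP.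
    have [k0|k0] := eqVneq (k ord0 i) 0.
      rewrite k0 (_ : mkset _ = [set 0])//.
      by apply/seteqP; split => x /= => [/eqP|->]; rewrite ?sgz0// sgz_cp0 => /eqP.
    have [k2|k2] := eqVneq (k ord0 i) (-1).
      rewrite k2 (_ : mkset _ = `]-oo, 0[%classic)//.
      by apply/seteqP; split => x /=; rewrite in_itv/= -sgz_cp0 => /eqP.
    rewrite (_ : mkset _ = set0)//; apply/seteqP; split => // x /= e.
    by move: k0 k1 k2; rewrite -e; case: sgzP.
  apply/seteqP; split => [u <- i _|u H]; first by rewrite /= !mxE.
  by apply/rowP => i; rewrite mxE; exact: H.
have piece k : nu (B `&` X `&` [set u | sign_pattern u = k]) =
    muJ (B `&` X `&` [set u | sign_pattern u = k]).
  set C := _ `&` _ `&` _.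
  have mC : measurable C by exact: measurableI.
  rewrite nuE// (_ : C `&` X = C); last first.
    by apply/seteqP; split => [u []//|u [[Bu Xu] ku]].
  have -> : psi2 gam lam E @` C = psi_pattern k @` C.
    by apply: eq_imagel => u [_ /= <-]; rewrite psi_patternE.
  rewrite (change_of_variables_set Hleb (differentiable_psi_pattern k)
    (fun j => continuous_derive_psi_pattern (k := k) (v := _)) mTh mC)//.
    by rewrite /muJ/= /with_density; apply: eq_integral => u _; rewrite jacobian_psi_pattern.
  by move=> u [[Bu Xu] /= ku]; rewrite -ku -psi_patternE ThX.
rewrite -nuE//.
have -> : nu B = nu (B `&` X).
  by rewrite !nuE// -setIA setIid.
apply/eqP; rewrite eq_le; apply/andP; split.
  apply: (@le_measure_fibers _ _ _ _ sign_pattern nu muJ) => // k.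
  by rewrite piece.
apply: (@le_measure_fibers _ _ _ _ sign_pattern muJ nu) => // k.
by rewrite piece.
Qed.

End sign_patterns.

(** * Null sets *)

Section null_sets.
Local Open Scope ereal_scope.
Import HBNNSimple.

(* Jpsi takes junk values where an active coordinate vanishes, so f1 and f2 may
   be non-measurable; but integrals of nonnegative functions are suprema over
   simple functions, which may be cut off outside N. *)
Lemma ge0_le_integral_off_null d (T : measurableType d) (R : realType)
    (mu : {measure set T -> \bar R}) (D N : set T) (f1 f2 : T -> \bar R) :
  measurable D -> measurable N -> mu N = 0 ->
  (forall x, D x -> 0 <= f1 x) -> (forall x, D x -> 0 <= f2 x) ->
  (forall x, D x -> ~ N x -> f1 x <= f2 x) ->
  \int[mu]_(x in D) f1 x <= \int[mu]_(x in D) f2 x.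
Proof.
move=> mD mN N0 f10 f20 f12; rewrite !ge0_integralE//.
apply: ge_ereal_sup => _ [h hf <-].
rewrite -integralT_nnsfun.
have mCN : measurable (~` N) by exact: measurableC.
have mh : measurable_fun setT (EFin \o h).
  by apply/measurable_EFinP; exact: measurable_funP.
rewrite (@ge0_negligible_integral _ _ _ mu setT N)//; last by move=> x _; rewrite lee_fin.
rewrite setTD integral_nnsfun// mrestrict; apply: ereal_sup_ubound.
exists (proj_nnsfun h mCN); last by [].
move=> x /=; rewrite mindicE/= patchE; case: ifPn => Dx.
  have [xN|xN] := boolP (x \in ~` N); last first.
    by rewrite mulr0; apply: f20; exact: set_mem.
  rewrite mulr1; apply: (@le_trans _ _ (f1 x)); last first.
    by apply: f12; [exact: set_mem|move/set_mem: xN].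
  by have := hf x; rewrite patchE Dx.
have := hf x; rewrite patchE (negbTE Dx) lee_fin => hx.
by rewrite lee_fin; case: (x \in _); rewrite ?mulr1 ?mulr0.
Qed.

Lemma ge0_integral_eq_off_null d (T : measurableType d) (R : realType)
    (mu : {measure set T -> \bar R}) (D N : set T) (f1 f2 : T -> \bar R) :
  measurable D -> measurable N -> mu N = 0 ->
  (forall x, D x -> 0 <= f1 x) -> (forall x, D x -> 0 <= f2 x) ->
  (forall x, D x -> ~ N x -> f1 x = f2 x) ->
  \int[mu]_(x in D) f1 x = \int[mu]_(x in D) f2 x.
Proof.
move=> mD mN N0 f10 f20 f12; apply/eqP; rewrite eq_le.
rewrite !(@ge0_le_integral_off_null _ _ _ mu D N)// => x Dx Nx; by rewrite f12.
Qed.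

Variables (R : realType) (p : nat).
Local Notation V := 'rV[R]_p.
Variable leb : {measure set V -> \bar R}.
Hypothesis Hleb : is_lebesgue_rV leb.

Lemma measurable_hyperplane (i : 'I_p) : measurable [set u : V | u ord0 i = 0%R].
Proof.
rewrite (_ : mkset _ = (fun u : V => u ord0 i) @^-1` [set 0%R])//.
by rewrite -[X in measurable X]setTI; apply: measurable_rV_coord.
Qed.

Lemma leb_hyperplane (i : 'I_p) : leb [set u : V | u ord0 i = 0%R] = 0.
Proof.
set H := mkset _; have mH : measurable H by exact: measurable_hyperplane.
apply/eqP; rewrite eq_le measure_ge0 andbT.
(* Comparison with the zero measure reduces the claim to the part of the hyperplane inside one
   cell. *)
pose null : {measure set V -> \bar R} := mscale (NngNum (lexx (0%R : R))) leb.
suff : leb H <= null H by rewrite /null /= /mscale/= mul0e.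
apply: (@le_measure_fibers _ _ _ _ (@cell R p 0)) => // [k|k].
  exact: (measurable_cell 0 [set k]).
rewrite /null /= /mscale/= mul0e.
(* This part sits in a closed box that is degenerate in direction i. *)
pose a : V := (\row_j (if j == i then 0 else (k ord0 j)%:~R))%R.
pose b : V := (\row_j (if j == i then 0 else (k ord0 j + 1)%:~R))%R.
have <- : leb [set x : V | forall j, (a ord0 j <= x ord0 j <= b ord0 j)%R] = 0.
  rewrite Hleb => [|j]; last by rewrite !mxE; case: eqP => // _; rewrite ler_int lerDl.
  by rewrite (bigD1 i)//= !mxE eqxx subrr mul0r.
apply: le_measure; rewrite ?inE.
- by apply: measurableI => //; exact: (measurable_cell 0 [set k]).
- exact: measurable_box.
- move=> x [/= xi /cell_eqP xk] j; rewrite !mxE; case: eqP => [->|_]; first by rewrite xi lexx.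
  by have /andP[] := xk j; rewrite expr0 mul1r => -> /ltW.
Qed.

Lemma measurable_coord_hyperplanes : measurable [set u : V | exists i, u ord0 i = 0%R].
Proof.
rewrite (_ : mkset _ = \bigcup_(i in @setT 'I_p) [set u : V | u ord0 i = 0%R]).
  apply: fin_bigcup_measurable; first exact: finite_finset.
  by move=> i _; exact: measurable_hyperplane.
by apply/seteqP; split => [u [i ui]|u [i _ ui]]; exists i.
Qed.

Lemma leb_coord_hyperplanes : leb [set u : V | exists i, u ord0 i = 0%R] = 0.
Proof.
apply/(negligibleP leb measurable_coord_hyperplanes).
rewrite (_ : mkset _ = \bigcup_n [set u : V | exists i : 'I_p, i = n :> nat /\ u ord0 i = 0%R]).
  apply: negligible_bigcup => n; have [np|np] := ltnP n p.
    apply: (negligibleS (A := [set u : V | u ord0 (Ordinal np) = 0%R])).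
      by move=> u [i [/= ei ui]]; rewrite (_ : Ordinal np = i)//; exact: val_inj.
    by apply/negligibleP; [exact: measurable_hyperplane|exact: leb_hyperplane].
  rewrite (_ : mkset _ = set0); first exact: negligible_set0.
  by apply/seteqP; split => // u [i [/= ei _]]; move: (ltn_ord i); rewrite ei ltnNge np.
apply/seteqP; split => [u [i ui]|u [n _ [i [_ ui]]]]; last by exists i.
by exists i => //; exists i.
Qed.

End null_sets.

(** * Joint measurability *)

Section joint_measurability.
Variables (R : realType) (p : nat) (dS : measure_display) (TS : measurableType dS).
Local Notation V := 'rV[R]_p.

(** Steps 1/(n+1) turn a derivative into a sequential limit, which preserves measurability in the
    parameter. *)
Lemma cvg_difference_quotient (W : normedModType R) (F : V -> W) (b v : V) :
  derivable F b v ->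
  n.+1%:R *: (F (n.+1%:R^-1 *: v + b) - F b) @[n --> \oo] --> 'D_v F b.
Proof.
move=> dF; have h0 : n.+1%:R^-1 @[n --> \oo] --> (0 : R)^'.
  move=> A [e /= e0 eA].
  have /cvgrPdist_lt/(_ _ e0) := @cvg_harmonic R.
  apply: filterS => n /= ne; apply: eA; last by rewrite gt_eqF// invr_gt0.
  by rewrite /ball/= distrC in ne *.
have := @cvg_comp _ _ _ (fun n => n.+1%:R^-1)
  (fun h => h^-1 *: ((F \o shift b) (h *: v) - F b)) \oo 0^' _ h0 dF.
apply: cvg_trans; apply: near_eq_cvg; apply: nearW => n /=.
by rewrite invrK.
Qed.

Lemma derive_coord (F : V -> V) (b v : V) (i : 'I_p) : derivable F b v ->
  n.+1%:R * (F (n.+1%:R^-1 *: v + b) ord0 i - F b ord0 i) @[n --> \oo] --> ('D_v F b) ord0 i.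
Proof.
move=> dF; have := @cvg_comp _ _ _
  (fun n => n.+1%:R *: (F (n.+1%:R^-1 *: v + b) - F b)) (fun M : V => M ord0 i) \oo _ _
  (cvg_difference_quotient dF) (@coord_continuous _ _ _ ord0 i ('D_v F b)).
apply: cvg_trans; apply: near_eq_cvg; apply: nearW => n /=.
by rewrite mxE mxBE.
Qed.

Variables (l : TS -> V -> R) (gam : TS -> V -> V).
Hypothesis ml : forall b, measurable_fun setT (fun s => l s b).
Hypothesis gl : forall s, C2_with_gradient (l s) (gam s).

Let dgam s b : differentiable (gam s) b. Proof. by case: (gl s). Qed.

Lemma measurable_gradient_coord b i : measurable_fun setT (fun s => gam s b ord0 i).
Proof.
pose e : V := delta_mx ord0 i.
apply: (@measurable_fun_cvg _ _ _ _
  (fun n s => n.+1%:R * (l s (n.+1%:R^-1 *: e + b) - l s b))).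
  by move=> n; apply: measurable_funM => //; apply: measurable_funB.
move=> s _; have [dl Dl _ _] := gl s.
have -> : gam s b ord0 i = 'D_e (l s) b.
  rewrite Dl /dotp (bigD1 i)//= big1 ?addr0 => [|j ji]; first by rewrite mxE !eqxx mulr1.
  by rewrite mxE (negbTE ji) andbF mulr0.
exact: (cvg_difference_quotient (diff_derivable (v := e) (dl b))).
Qed.

Lemma measurable_gradient : measurable_fun setT (fun x : TS * V => gam x.1 x.2).
Proof.
apply: measurable_fun_rVP => i.
apply: (measurable_caratheodory (F := fun s b => gam s b ord0 i)).
  by move=> b; exact: measurable_gradient_coord.
move=> s b; apply: (@continuous_comp _ _ _ (gam s) (fun M : V => M ord0 i)).
  exact: differentiable_continuous.
exact: coord_continuous.
Qed.

Lemma measurable_derive_gradient (v : V) i :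
  measurable_fun setT (fun x : TS * V => ('D_v (gam x.1) x.2) ord0 i).
Proof.
apply: (measurable_caratheodory (F := fun s b => ('D_v (gam s) b) ord0 i)).
  move=> b; apply: (@measurable_fun_cvg _ _ _ _
    (fun n s => n.+1%:R * (gam s (n.+1%:R^-1 *: v + b) ord0 i - gam s b ord0 i))).
    move=> n; apply: measurable_funM => //.
    by apply: measurable_funB; exact: measurable_gradient_coord.
  by move=> s _; apply: derive_coord; exact: diff_derivable.
move=> s b; have [_ _ _ cD] := gl s.
apply: (@continuous_comp _ _ _ (fun b => 'D_v (gam s) b) (fun M : V => M ord0 i)).
  exact: cD.
exact: coord_continuous.
Qed.

Lemma measurable_sgr : measurable_fun setT (Num.sg : R -> R).
Proof.
apply: nondecreasing_measurable => // x y xy.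
have [x0|x0|x0] := ltrgtP x 0; have [y0|y0|y0] := ltrgtP y 0;
  rewrite ?x0 ?y0 ?(ltr0_sg x0) ?(ltr0_sg y0) ?(gtr0_sg x0) ?(gtr0_sg y0) ?sgr0//; lra.
Qed.

Variables (lam : R) (E : {set 'I_p}).

Let mfst : measurable_fun setT (fst : TS * V -> TS). Proof. exact: measurable_fst. Qed.
Let msnd : measurable_fun setT (snd : TS * V -> V). Proof. exact: measurable_snd. Qed.
Let mcoord i : measurable_fun setT (fun x : TS * V => x.2 ord0 i).
Proof. exact: (measurableT_comp (measurable_rV_coord i) msnd). Qed.

Lemma measurable_psi2 : measurable_fun setT (fun x : TS * V => psi2 (gam x.1) lam E x.2).
Proof.
apply: measurable_fun_rVP => i.
rewrite (_ : (fun _ => _) = (fun x : TS * V => gam x.1 (x.2 *m activeP R E) ord0 i +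
    lam * (if i \in E then Num.sg (x.2 ord0 i) else x.2 ord0 i))); last first.
  apply/funext => x; rewrite /psi2 mulmx_activeP mxE; congr (_ + _).
  by rewrite mxE [zOf _ _ _ _]mxE.
apply: measurable_funD.
  apply: (measurableT_comp (measurable_rV_coord i)).
  have : measurable_fun setT (fun x : TS * V => (x.1, x.2 *m activeP R E)).
    apply: measurable_fun_pair => //.
    exact: (measurableT_comp (measurable_mulmxr (activeP R E)) msnd).
  exact: (measurableT_comp measurable_gradient).
apply: measurable_funM => //; have [iE|iE] := boolP (i \in E); last exact: mcoord.
exact: (measurableT_comp measurable_sgr (mcoord i)).
Qed.

Lemma measurable_abs_det_jac :
  measurable_fun setT (fun x : TS * V => `|\det (jac (gam x.1) lam E x.2)|).
Proof.
apply: (measurableT_comp (@normr_measurable R setT)).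
rewrite /determinant; apply: measurable_sum => s.
apply: measurable_funM; first exact: measurable_cst.
apply: measurable_prod => j _.
under eq_fun do rewrite mxE mxE.
apply: measurable_funD => //.
have : measurable_fun setT (fun x : TS * V => (x.1, x.2 *m activeP R E)).
  apply: measurable_fun_pair => //.
  exact: (measurableT_comp (measurable_mulmxr (activeP R E)) msnd).
exact: (measurableT_comp (measurable_derive_gradient _ _)).
Qed.

Variable bhat : TS -> V -> V.
Hypothesis mbhat : measurable_fun setT (fun x : TS * V => bhat x.1 x.2).

Lemma measurable_free_estimate :
  measurable_fun setT (fun x : TS * V => free_estimate (gam x.1) lam E (bhat x.1) x.2).
Proof.
apply: measurable_fun_rVP => i.
have mb : measurable_fun setT (fun x : TS * V => bhat x.1 x.2 ord0 i).
  exact: (measurableT_comp (measurable_rV_coord i) mbhat).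
rewrite (_ : (fun _ => _) = (fun x : TS * V => if i \in E then bhat x.1 x.2 ord0 i
    else lam^-1 * (x.2 ord0 i - gam x.1 (bhat x.1 x.2) ord0 i))); last first.
  apply/funext => x; rewrite /free_estimate mxE.
  by have [//|iE] := boolP (i \in E); rewrite mxE mxBE.
have [//|iE] := boolP (i \in E).
apply: measurable_funM => //; apply: measurable_funB => //.
apply: (measurableT_comp (measurable_rV_coord i)).
have : measurable_fun setT (fun x : TS * V => (x.1, bhat x.1 x.2)).
  exact: measurable_fun_pair.
exact: (measurableT_comp measurable_gradient).
Qed.

Lemma measurable_free_coords : measurable (@free_coords R p E).
Proof.
rewrite (_ : free_coords E = \bigcap_(i in [set i | i \notin E])
    (fun u : V => u ord0 i) @^-1` `](-1), 1[%classic).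
  apply: fin_bigcap_measurable; first exact: finite_finset.
  by move=> i _; rewrite -[X in measurable X]setTI; apply: measurable_rV_coord.
apply/seteqP; split => u H i iE; have := H i iE; rewrite /= in_itv/= ltr_norml//.
Qed.

End joint_measurability.

(** * The selective law *)

Section selective_density.
Variables (R : realType) (p : nat) (dS : measure_display) (TS : measurableType dS).
Local Notation V := 'rV[R]_p.
Variables (mu : {sigma_finite_measure set TS -> \bar R})
  (leb : {sigma_finite_measure set V -> \bar R}).
Hypothesis Hleb : is_lebesgue_rV leb.
Variables (f : TS -> R) (g : V -> R).
Hypotheses (Hf : is_density mu f) (Hg : is_density leb g).
Variables (lam : R) (l : TS -> V -> R) (gam : TS -> V -> V).
Hypothesis Hlam : 0 < lam.
Hypothesis ml : forall b, measurable_fun setT (fun s => l s b).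
Hypothesis cl : forall s, convex_fun (l s).
Hypothesis gl : forall s, C2_with_gradient (l s) (gam s).
Variable bhat : TS -> V -> V.
Hypothesis bhatP : forall s w,
  unique_minimizer (fun b => l s b + lam * norm1 b - dotp w b) (bhat s w).
Hypothesis mbhat : measurable_fun setT (fun x : TS * V => bhat x.1 x.2).
Variable E : {set 'I_p}.

Local Open Scope ereal_scope.

Local Notation psi s := (psi2 (gam s) lam E).
Local Notation Th s := (free_estimate (gam s) lam E (bhat s)).
Local Notation Jac s u := (`|\det (jac (gam s) lam E u)|)%R.
Local Notation X := (@free_coords R p E).

Let f0 s : (0 <= f s)%R. Proof. by case: Hf. Qed.
Let g0 w : (0 <= g w)%R. Proof. by case: Hg. Qed.
Let mf : measurable_fun setT f. Proof. by case: Hf. Qed.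
Let mg : measurable_fun setT g. Proof. by case: Hg. Qed.
Let mX : measurable X. Proof. exact: measurable_free_coords. Qed.
Let mpsi : measurable_fun setT (fun x : TS * V => psi x.1 x.2).
Proof. exact: (measurable_psi2 ml gl). Qed.
Let mTh : measurable_fun setT (fun x : TS * V => Th x.1 x.2).
Proof. exact: (measurable_free_estimate ml gl lam E mbhat). Qed.
Let mJac : measurable_fun setT (fun x : TS * V => Jac x.1 x.2).
Proof. exact: (measurable_abs_det_jac ml gl). Qed.

Let event (s : TS) : set V := psi s @` X.

Let fiber_change_of_variables s (D : set V) : measurable D ->
  \int[leb]_(w in psi s @` (D `&` X)) (g w)%:E =
  \int[leb]_(u in D `&` X) (g (psi s u) * Jac s u)%:E.
Proof.
move=> mD.
have mps : measurable_fun setT (psi s) := measurableT_comp mpsi (pair1_measurable s).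
have mTs : measurable_fun setT (Th s) := measurableT_comp mTh (pair1_measurable s).
have mJs : measurable_fun setT (fun u => Jac s u) := measurableT_comp mJac (pair1_measurable s).
have ThX u : X u -> Th s (psi s u) = u.
  exact: (free_estimate_psi2 Hlam (cl s) (gl s) (bhatP s)).
have [dg cg] : (forall b, differentiable (gam s) b) /\
    (forall v, continuous (fun b => 'D_v (gam s) b)) by case: (gl s).
have mE : measurable (psi s @` (D `&` X)) by exact: (measurable_image mps mTs).
have transfer B : measurable B -> leb (psi s @` (D `&` X) `&` Th s @^-1` B) =
    \int[leb]_(u in (D `&` X) `&` B) (Jac s u)%:E.
  move=> mB; rewrite (_ : _ `&` _ = psi s @` ((D `&` B) `&` X)); last first.
    apply/seteqP; split => [_ [[u [Du Xu] <-]] /=|_ [u [[Du Bu] Xu] <-]].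
      by rewrite ThX// => Bu; exists u.
    by split; [exists u|rewrite /= ThX].
  rewrite (psi2_change_of_variables dg cg Hleb mps mTs mJs mX ThX (measurableI _ _ mD mB)).
  by rewrite setIAC.
have := ge0_integral_transfer mTs mE (measurableI _ _ mD mX)
  (fun u => normr_ge0 (\det (jac (gam s) lam E u))) mJs transfer
  (measurableT_comp mg mps) (fun u => g0 (psi s u)).
move=> <-; apply: eq_integral => w /set_mem[u [Du Xu] <-] /=.
by rewrite ThX.
Qed.

Let integral_sections (k : TS * V -> R) (C : set (TS * V)) : measurable C ->
  measurable_fun setT k -> (forall x, 0 <= k x)%R ->
  \int[mu \x leb]_(x in C) (k x)%:E =
  \int[mu]_s \int[leb]_(w in [set w | C (s, w)]) (k (s, w))%:E.
Proof.
move=> mC mk k0; rewrite integral_mkcond fubini_tonelli1.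
- apply: eq_integral => s _; rewrite /fubini_F [RHS]integral_mkcond.
  apply: eq_integral => w _; rewrite !patchE.
  have [/set_mem h|/negP h] := boolP ((s, w) \in C).
    by rewrite mem_set.
  by case: ifPn => // /set_mem/= /mem_set.
- apply/(measurable_restrictT _ _).1 => //; apply/measurable_EFinP.
  exact: measurable_funTS.
- by move=> x; rewrite patchE; case: ifP => // _; rewrite lee_fin.
Qed.

Let Ev : set (TS * V) := [set x | event x.1 x.2].

(** Describes the event by jointly measurable maps in (s, w), which the union of fiberwise images
    does not show. *)
Let EvE : Ev = [set x | X (Th x.1 x.2)] `&` [set x | psi x.1 (Th x.1 x.2) = x.2].
Proof.
have ThX s u : X u -> Th s (psi s u) = u.
  exact: (free_estimate_psi2 Hlam (cl s) (gl s) (bhatP s)).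
apply/seteqP; split => [[s w] [/= u Xu <-]|[s w] [/= Xw wE]].
  by rewrite ThX.
by exists (Th s w).
Qed.

Let measurable_preTh (A : set (TS * V)) : measurable A ->
  measurable [set x : TS * V | A (x.1, Th x.1 x.2)].
Proof.
move=> mA; rewrite -[X in measurable X]setTI.
exact: (measurable_fun_pair measurable_fst mTh).
Qed.

Let measurable_event : measurable Ev.
Proof.
rewrite EvE; apply: measurableI.
  rewrite -[X in measurable X]setTI; exact: mTh.
apply: measurable_eq_rV; last exact: measurable_snd.
have : measurable_fun setT (fun x : TS * V => (x.1, Th x.1 x.2)).
  exact: (measurable_fun_pair measurable_fst mTh).
exact: (measurableT_comp mpsi).
Qed.

Lemma selective_law (A : set (TS * V)) : measurable A ->
  \int[mu \x leb]_(x in [set x | A (x.1, Th x.1 x.2)] `&` Ev) (f x.1 * g x.2)%:E =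
  \int[mu \x leb]_(y in A) (f y.1 * g (psi y.1 y.2) * Jpsi (gam y.1) lam E y.2
       * (if `[< inB E (betaOf E y.2) (zOf E y.2) >] then 1 else 0))%:E.
Proof.
move=> mA.
have ThX s u : X u -> Th s (psi s u) = u.
  exact: (free_estimate_psi2 Hlam (cl s) (gl s) (bhatP s)).
have mgpsi : measurable_fun setT (fun y : TS * V => g (psi y.1 y.2)) := measurableT_comp mg mpsi.
have mf1 : measurable_fun setT (fun y : TS * V => f y.1) := measurableT_comp mf measurable_fst.
have mX2 : measurable [set y : TS * V | X y.2].
  by rewrite -[X in measurable X]setTI; exact: measurable_snd.
pose N : set (TS * V) := setT `*` [set u : V | exists i, u ord0 i = 0%R].
have mN : measurable N.
  by apply: measurableX => //; exact: measurable_coord_hyperplanes.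
have N0 : (mu \x leb) N = 0.
  rewrite product_measure1E//; last exact: measurable_coord_hyperplanes.
  by rewrite leb_coord_hyperplanes// mule0.
pose h' (y : TS * V) := (f y.1 * (g (psi y.1 y.2) * Jac y.1 y.2))%R.
(* Off the null set N, [Jpsi] equals the measurable |det jac| and the indicator of B is that of X,
   so Tonelli applies to the new integrand. *)
rewrite [RHS](@ge0_integral_eq_off_null _ _ _ _ _ N _
    ((fun y => (h' y)%:E) \_ [set y | X y.2]))//; last 3 first.
- move=> y _; rewrite lee_fin !mulr_ge0//; first by rewrite /Jpsi.
  by case: asboolP.
- move=> y _; rewrite patchE; case: ifP => // _; rewrite lee_fin !mulr_ge0//.
- move=> y _ yN; rewrite patchE; case: asboolP => /inB_free Xy; last first.
    by rewrite mulr0 memNset.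
  rewrite mem_set// mulr1 /h' JpsiE ?mulrA//.
    by case: (gl y.1).
  by move=> i iE; apply/eqP => yi; apply: yN; split => //; exists i.
have mC1 : measurable ([set x | A (x.1, Th x.1 x.2)] `&` Ev).
  by apply: measurableI => //; exact: measurable_preTh.
have mC2 : measurable (A `&` [set y | X y.2]) by exact: measurableI.
have mk1 : measurable_fun setT (fun x : TS * V => f x.1 * g x.2)%R.
  by apply: measurable_funM => //; exact: (measurableT_comp mg measurable_snd).
have mk2 : measurable_fun setT h'.
  by apply: measurable_funM => //; exact: measurable_funM.
have k10 (x : TS * V) : (0 <= f x.1 * g x.2)%R by rewrite mulr_ge0.
have k20 (x : TS * V) : (0 <= h' x)%R by rewrite !mulr_ge0.
rewrite -integral_mkcondr (integral_sections mC1 mk1 k10) (integral_sections mC2 mk2 k20).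
apply: eq_integral => s _; rewrite /h' /=.
pose D := [set u | A (s, u)].
have mD : measurable D.
  by rewrite -[X in measurable X]setTI; exact: (pair1_measurable s).
(* Over s the event in w is the [psi s]-image of the section of A within X: the domain of the
   fiberwise change of variables. *)
have -> : [set w | ([set x | A (x.1, Th x.1 x.2)] `&` Ev) (s, w)] = psi s @` (D `&` X).
  apply/seteqP; split => [w [/= Aw [u Xu /= uw]]|_ [u [Du Xu] <-]].
    by exists u => //; split => //; move: Aw; rewrite -uw ThX.
  by split; [rewrite /= ThX|exists u].
have -> : [set w | (A `&` [set y | X y.2]) (s, w)] = D `&` X by [].
have mps : measurable_fun setT (psi s) := measurableT_comp mpsi (pair1_measurable s).
have mTs : measurable_fun setT (Th s) := measurableT_comp mTh (pair1_measurable s).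
have mJs : measurable_fun setT (fun u => Jac s u) := measurableT_comp mJac (pair1_measurable s).
have mDX : measurable (D `&` X) by exact: measurableI.
have mI : measurable (psi s @` (D `&` X)).
  by apply: (measurable_image mps mTs) => //; exact: ThX.
under eq_integral do rewrite EFinM.
under [RHS]eq_integral do rewrite EFinM.
rewrite ge0_integralZl_EFin//; last 2 first.
- by move=> w _; rewrite lee_fin.
- by apply/measurable_EFinP; exact: measurable_funTS.
rewrite ge0_integralZl_EFin//; last 2 first.
- by move=> w _; rewrite lee_fin mulr_ge0.
- apply/measurable_EFinP; apply: measurable_funTS; apply: measurable_funM => //.
  exact: measurableT_comp.
by rewrite fiber_change_of_variables.
Qed.

(** The total mass of F x G is 1; finiteness on the event makes the normalizing constant a real
    number. *)
Lemma event_law_lty : \int[mu \x leb]_(x in Ev) (f x.1 * g x.2)%:E < +oo.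
Proof.
have mk1 : measurable_fun setT (fun x : TS * V => f x.1 * g x.2)%R.
  apply: measurable_funM; first exact: (measurableT_comp mf measurable_fst).
  exact: (measurableT_comp mg measurable_snd).
have k10 (x : TS * V) : (0 <= f x.1 * g x.2)%R by rewrite mulr_ge0.
apply: (@le_lt_trans _ _ (\int[mu \x leb]_(x in setT) (f x.1 * g x.2)%:E)).
  apply: ge0_subset_integral => //; first exact/measurable_EFinP.
  by move=> x _; rewrite lee_fin.
rewrite (integral_sections measurableT mk1 k10).
under eq_integral => s _.
  rewrite (_ : [set w | setT (s, w)] = setT)//.
  under eq_integral do rewrite EFinM /=.
  rewrite ge0_integralZl_EFin//; last 2 first.
  - by move=> w _; rewrite lee_fin.
  - exact/measurable_EFinP.
  have [_ _ ->] := Hg; rewrite mule1.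
  over.
by have [_ _ ->] := Hf; exact: ltry.
Qed.

End selective_density.

Unset Implicit Arguments.

Theorem theorem2 (R : realType) (p : nat)
  (dS : measure_display) (TS : measurableType dS)
  (mu : {sigma_finite_measure set TS -> \bar R})
  (leb : {sigma_finite_measure set 'rV[R]_p -> \bar R})
  (Hleb : is_lebesgue_rV leb)
  (f : TS -> R) (g : 'rV[R]_p -> R)
  (Hf : is_density mu f) (Hg : is_density leb g)
  (lam : R) (Hlam : 0 < lam)
  (l : TS -> 'rV[R]_p -> R) (gam : TS -> 'rV[R]_p -> 'rV[R]_p)
  (Hl_meas : forall b, measurable_fun setT (fun s => l s b))
  (Hl_conv : forall s, convex_fun (l s))
  (Hl_C2 : forall s, C2_with_gradient (l s) (gam s))
  (bhat : TS -> 'rV[R]_p -> 'rV[R]_p)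
  (Hbhat : forall s w,
     unique_minimizer (fun b => l s b + lam * norm1 b - dotp w b) (bhat s w))
  (Hbhat_meas : measurable_fun setT (fun x : TS * 'rV[R]_p => bhat x.1 x.2))
  (E : {set 'I_p}) :
  let zhat := fun s w => lam^-1 *: (w - gam s (bhat s w)) in
  (* joint law F x G of (S, omega) *)
  let P := fun A : set (TS * 'rV[R]_p) =>
             (\int[mu \x leb]_(x in A) (f x.1 * g x.2)%:E)%E in
  (* the conditioning event {(bhat, zhat) in B} *)
  let Ev := [set x : TS * 'rV[R]_p | inB E (bhat x.1 x.2) (zhat x.1 x.2)] in
  (* the proposed (unnormalized) density of (S, bhat_E, zhat_{-E}) *)
  let h := fun y : TS * 'rV[R]_p =>
     f y.1 * g (psi2 (gam y.1) lam E y.2) * Jpsi (gam y.1) lam E y.2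
       * (if `[< inB E (betaOf E y.2) (zOf E y.2) >] then 1 else 0) in
  (0 < P Ev)%E ->
  exists c : R, 0 < c /\
    forall A : set (TS * 'rV[R]_p), measurable A ->
      P ([set x | A (x.1, packBZ E (bhat x.1 x.2) (zhat x.1 x.2))] `&` Ev)
      = (P Ev * (c%:E * \int[mu \x leb]_(y in A) (h y)%:E))%E.
Proof.
move=> zhat P Ev h P0.
have EvE : Ev = [set x | (psi2 (gam x.1) lam E @` @free_coords R p E) x.2].
  apply/seteqP; split => -[s w] /=;
    have /seteqP[h1 h2] := event_image E Hlam (Hl_conv s) (Hl_C2 s) (Hbhat s).
    exact: h1.
  exact: h2.
have Pfin : P Ev \is a fin_num.
  rewrite ge0_fin_numE ?(ltW P0)// /P EvE.
  exact: (event_law_lty Hf Hg Hlam Hl_meas Hl_conv Hl_C2 Hbhat Hbhat_meas).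
have c0 : 0 < fine (P Ev) by rewrite fine_gt0// P0 ltey_eq Pfin.
(* The constant 1 / P(Ev) cancels the factor [P Ev] by which the conditional law was multiplied
   out. *)
exists (fine (P Ev))^-1; split; first by rewrite invr_gt0.
move=> A mA.
rewrite muleA -{1}(fineK Pfin) -EFinM divff ?gt_eqF// mul1e /P EvE.
exact: (selective_law Hleb Hf Hg Hlam Hl_meas Hl_conv Hl_C2 Hbhat Hbhat_meas).
Qed.
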